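(* Let $\mu$ be a probability distribution on $\{0,1,2,\dots\}$ with $\sum_{i\ge 0} i\,\mu(i)>1$ (the mean may be infinite), let $T$ be a Galton--Watson tree with offspring distribution $\mu$ conditioned to survive, and let $\mathcal{C}(T)$ be the associated causal map. Then: 1. The map $\mathcal{C}(T)$ is almost surely weakly anchored hyperbolic. 2. The map $\mathcal{C}(T)$ almost surely admits bi-infinite geodesics, i.e. paths $(\gamma(i))_{i\in\mathbb{Z}}$ such that for any $i,j\in\mathbb{Z}$ the graph distance in $\mathcal{C}(T)$ between $\gamma(i)$ and $\gamma(j)$ is exactly $|i-j|$.
   Context: Trees are plane (ordered), locally finite, rooted at a vertex $\rho$; the height of a vertex is its distance to $\rho$ in the tree. Causal map: for a plane tree $t$, $\mathcal{C}(t)$ is the planar map, rooted at $\rho$, obtained from $t$ by adding at each height $h\ge 1$ the horizontal edges between consecutive vertices in left-to-right order, including one between the rightmost and the leftmost vertices of height $h$ (so each level is a cycle, and each vertex $v\neq\rho$ with $c(v)$ children has degree $c(v)+3$ in $\mathcal{C}(t)$; a loop if the level has one vertex, a double edge if it has two). Weak anchored hyperbolicity: a rooted planar map $M$ with root vertex $\rho$ and graph distance $d_M$ is weakly anchored hyperbolic if there is a constant $k\ge 0$ such that the following holds. Let $x,y,z$ be three vertices of $M$ and let $\gamma_{xy}$ (resp. $\gamma_{yz}$, $\gamma_{zx}$) be a geodesic of $M$ from $x$ to $y$ (resp. from $y$ to $z$, from $z$ to $x$). If the triangle formed by $\gamma_{xy},\gamma_{yz},\gamma_{zx}$ surrounds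 $\rho$ (in the plane, $\rho$ is not in the unbounded component of the complement of the triangle), then $d_M(\rho,\gamma_{xy}\cup\gamma_{yz}\cup\gamma_{zx})\le k$. The constant $k$ may depend on the realization of the random map. *)

(* Defs.v *)
From HB Require Import structures.
From mathcomp Require Import all_boot all_order all_algebra.
From mathcomp Require Import all_classical all_reals all_analysis.
From mathcomp Require Import ring lra.

Set Implicit Arguments.
Unset Strict Implicit.
Unset Printing Implicit Defensive.

Import Order.TTheory GRing.Theory Num.Theory.
Import numFieldNormedType.Exports.

Local Open Scope classical_set_scope.
Local Open Scope ring_scope.

(** * Rooted maps drawn in the plane *)

(** Loops and multiple edges are allowed. Only the restriction of [edge_curve e]
    to the unit interval matters. The last three fields say that the drawing is
    an embedding: distinct vertices have distinct positions, and the edges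
    without their endpoints are simple, pairwise disjoint, and avoid the
    vertices. *)
Record plane_map (R : realType) := PlaneMap {
  vertex : Type;
  edge : Type;
  root : vertex;
  edge_src : edge -> vertex;
  edge_tgt : edge -> vertex;
  vertex_pos : vertex -> R * R;
  edge_curve : edge -> R -> R * R;
  edge_curve_cts : forall e, continuous (edge_curve e);
  edge_curve0 : forall e, edge_curve e 0 = vertex_pos (edge_src e);
  edge_curve1 : forall e, edge_curve e 1 = vertex_pos (edge_tgt e);
  vertex_pos_inj : injective vertex_pos;
  edge_curve_inj : forall e e' s s', 0 < s < 1 -> 0 < s' < 1 ->
    edge_curve e s = edge_curve e' s' -> e = e' /\ s = s';
  edge_curve_vertex : forall e s v, 0 < s < 1 ->
    edge_curve e s <> vertex_pos v
}.
Arguments root {R}.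

Section paths.
Context {R : realType} {M : plane_map R}.
Implicit Types (x y : vertex M).

(** An oriented edge: [(e, true)] goes from [edge_src e] to [edge_tgt e],
    [(e, false)] backwards. *)
Definition dart := (edge M * bool)%type.

Definition dart_src (a : dart) := if a.2 then edge_src a.1 else edge_tgt a.1.
Definition dart_tgt (a : dart) := if a.2 then edge_tgt a.1 else edge_src a.1.

Fixpoint is_path x (p : seq dart) y : Prop :=
  if p is a :: p' then dart_src a = x /\ is_path (dart_tgt a) p' y else x = y.

Fixpoint path_vertices x (p : seq dart) : set (vertex M) :=
  if p is a :: p' then x |` path_vertices (dart_tgt a) p' else [set x].

Fixpoint path_support x (p : seq dart) : set (R * R) :=
  if p is a :: p'
  then (edge_curve a.1 @` `[0, 1]) `|` path_support (dart_tgt a) p'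
  else [set vertex_pos x].

Definition graph_dist x y : \bar R :=
  ereal_inf [set (size p)%:R%:E | p in [set p | is_path x p y]].

Definition dist_to_set x (A : set (vertex M)) : \bar R :=
  ereal_inf [set graph_dist x v | v in A].

Definition geodesic x p y := is_path x p y /\ graph_dist x y = (size p)%:R%:E.

Definition bi_infinite_geodesic (g : int -> vertex M) :=
  forall i j : int, graph_dist (g i) (g j) = (`|i - j|%:~R)%:E.

End paths.

(** [o] is not in an unbounded component of the complement of [K]; in
    particular this holds when [K o], since [connected_component (~` K) o] is
    then empty. *)
Definition surrounds {R : realType} (K : set (R * R)) (o : R * R) :=
  bounded_set (connected_component (~` K) o).

Definition weakly_anchored_hyperbolic {R : realType} (M : plane_map R) :=
  exists2 k : R, 0 <= k &
    forall (x y z : vertex M) (pxy pyz pzx : seq dart),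
      geodesic x pxy y -> geodesic y pyz z -> geodesic z pzx x ->
      surrounds (path_support x pxy `|` path_support y pyz
                   `|` path_support z pzx) (vertex_pos (root M)) ->
      (dist_to_set (root M) (path_vertices x pxy `|` path_vertices y pyz
                   `|` path_vertices z pzx) <= k%:E)%E.

(** * Plane trees *)

(** In the Ulam-Harris encoding, the root is [[::]] and [rcons u i] is the child
    number [i] of [u], the children being numbered from left to right. A tree is
    given by [t], where [t u] is the number of children of [u]; the values of [t]
    at words which are not vertices are irrelevant. *)
Definition plane_tree := seq nat -> nat.

(** The vertices of height [h], from left to right. *)
Fixpoint level (t : plane_tree) (h : nat) : seq (seq nat) :=
  if h is h'.+1
  then flatten [seq [seq rcons u i | i <- iota 0 (t u)] | u <- level t h']
  else [:: [::]].

Definition in_tree (t : plane_tree) (u : seq nat) := u \in level t (size u).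

Definition tree_vertex (t : plane_tree) := {u : seq nat | in_tree t u}.

Definition parent (u : seq nat) := take (size u).-1 u.

Definition survives (t : plane_tree) := forall h, level t h != [::].

Section tree_lemmas.
Variable t : plane_tree.

Lemma level_size h u : u \in level t h -> size u = h.
Proof.
elim: h u => [|h IH] u /=; first by rewrite inE => /eqP->.
by case/flatten_mapP=> v /IH <- /mapP[i _ ->]; rewrite size_rcons.
Qed.

Lemma parent_rcons u i : parent (rcons u i) = u.
Proof. by rewrite /parent size_rcons/= -cats1 take_size_cat. Qed.

Lemma level_uniq h : uniq (level t h).
Proof.
elim: h => [//|h IH] /=.
elim: (level t h) IH => [//|u s IHs] /= /andP[us /IHs us'].
rewrite cat_uniq us' andbT map_inj_uniq ?iota_uniq/=; last first.
  by move=> i j /rcons_inj[].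
apply/hasPn => w /flatten_mapP[v vs /mapP[i _ ->]].
apply/negP => /mapP[j _ /rcons_inj[vu _]].
by move: us; rewrite -vu vs.
Qed.

Lemma level_parent h u : u \in level t h.+1 -> parent u \in level t h.
Proof. by case/flatten_mapP=> v vh /mapP[i _ ->]; rewrite parent_rcons. Qed.

Lemma in_tree_nil : in_tree t [::]. Proof. by rewrite /in_tree/= inE. Qed.

Lemma in_tree_parent u : in_tree t u -> in_tree t (parent u).
Proof.
rewrite /in_tree; case: (lastP u) => [//|v i].
by rewrite size_rcons => /level_parent; rewrite parent_rcons.
Qed.

Lemma in_tree_next u : in_tree t u -> in_tree t (next (level t (size u)) u).
Proof.
rewrite /in_tree -(mem_next _ u) => nu.
by rewrite (level_size nu).
Qed.

Lemma index_parent h u v : u \in level t h.+1 -> v \in level t h.+1 ->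
  (index (parent u) (level t h) < index (parent v) (level t h))%N ->
  (index u (level t h.+1) < index v (level t h.+1))%N.
Proof.
move=> uh vh puv.
have pu := level_parent uh; have pv := level_parent vh.
have := level_uniq h; move: puv uh vh => /=.
case/splitPr: pu pv => s1 s2.
set p := parent u; set q := parent v => qs pq uh vh us.
move: us; rewrite cat_uniq/= => /and3P[_ /norP[ps1 /hasPn s12] /andP[ps2 us2]].
have qs1 : q \notin s1.
  apply/negP => qs1; move: pq; rewrite !index_cat qs1 (negbTE ps1)/= eqxx addn0.
  by rewrite ltnNge index_size.
have qp : q != p by apply/eqP => qp; move: pq; rewrite qp ltnn.
have blk (w x : seq nat) : w \in [seq rcons x i | i <- iota 0 (t x)] ->
    parent w = x.
  by move=> /mapP[i _ ->]; rewrite parent_rcons.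
have vn s : q \notin s ->
   v \notin flatten [seq [seq rcons x i | i <- iota 0 (t x)] | x <- s].
  move=> qns; apply/negP => /flatten_mapP[x xs /blk]; rewrite -/q => qx.
  by rewrite -qx in xs; rewrite xs in qns.
have un s : p \notin s ->
   u \notin flatten [seq [seq rcons x i | i <- iota 0 (t x)] | x <- s].
  move=> qns; apply/negP => /flatten_mapP[x xs /blk]; rewrite -/p => qx.
  by rewrite -qx in xs; rewrite xs in qns.
have ub : u \in [seq rcons p i | i <- iota 0 (t p)].
  move: uh; rewrite map_cat flatten_cat mem_cat (negbTE (un _ ps1))/=.
  by rewrite mem_cat (negbTE (un _ ps2)) orbF.
have vb : v \notin [seq rcons p i | i <- iota 0 (t p)].
  by apply/negP => /blk; rewrite -/q; apply/eqP.
rewrite map_cat flatten_cat/= !index_cat (negbTE (un _ ps1)) (negbTE (vn _ qs1)).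
rewrite ub (negbTE vb) ltn_add2l.
by apply: ltn_addr; rewrite index_mem.
Qed.

End tree_lemmas.

(** * Causal maps *)

Section causal_map.
Variables (R : realType) (t : plane_tree).

Definition nonroot := {u : seq nat | in_tree t u && (u != [::])}.

Lemma nonroot_in_tree (u : nonroot) : in_tree t (val u).
Proof. by case/andP: (valP u). Qed.

(** [tree_edge v] joins the parent of [v] to [v], and [level_edge v] joins [v] to
    the next vertex of its level in cyclic order. *)
Inductive causal_edge := tree_edge of nonroot | level_edge of nonroot.

Definition causal_src (e : causal_edge) : tree_vertex t :=
  match e with
  | tree_edge v => exist (in_tree t) (parent (val v)) (in_tree_parent (nonroot_in_tree v))
  | level_edge v => exist (in_tree t) (val v) (nonroot_in_tree v)
  end.

Definition causal_tgt (e : causal_edge) : tree_vertex t :=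
  match e with
  | tree_edge v => exist (in_tree t) (val v) (nonroot_in_tree v)
  | level_edge v => exist (in_tree t) (next (level t (size (val v))) (val v))
      (in_tree_next (nonroot_in_tree v))
  end.

(** Level [h] is spread counterclockwise on the circle of radius [h] around the
    origin, starting at angle [0]; edges between levels interpolate linearly in
    polar coordinates, with angles at least [0] and less than [2 * pi], and the
    last edge of a level closes the circle. *)
Definition polar (r a : R) : R * R := (r * cos a, r * sin a).

Definition angle_step (u : seq nat) : R :=
  2 * pi / (size (level t (size u)))%:R.

Definition angle (u : seq nat) : R :=
  (index u (level t (size u)))%:R * angle_step u.

Definition causal_pos (v : tree_vertex t) : R * R :=
  polar (size (val v))%:R (angle (val v)).

Definition causal_curve (e : causal_edge) (s : R) : R * R :=
  match e with
  | tree_edge v => let p := parent (val v) in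
      polar ((size p)%:R + s) ((1 - s) * angle p + s * angle (val v))
  | level_edge v =>
      polar (size (val v))%:R (angle (val v) + s * angle_step (val v))
  end.

Lemma polar_inj r r' a a' : 0 <= r -> 0 <= r' ->
  0 <= a < 2 * pi -> 0 <= a' < 2 * pi ->
  polar r a = polar r' a' -> r = r' /\ (r = 0 \/ a = a').
Proof.
move=> r0 r'0 Ha Ha' [e1 e2].
have rr : r = r'.
  apply/eqP; rewrite -(eqrXn2 (n := 2))//.
  have <- : (r * cos a) ^+ 2 + (r * sin a) ^+ 2 = r ^+ 2.
    by rewrite !exprMn -mulrDr cos2Dsin2 mulr1.
  by rewrite e1 e2 !exprMn -mulrDr cos2Dsin2 mulr1.
split => //; case: (eqVneq r 0) => [|rn0]; [by left|right].
move: e1 e2; rewrite -rr => /(mulfI rn0) ec /(mulfI rn0) es.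
have c1 : cos (a - a') = 1.
  by rewrite cosB -ec -es -!expr2 cos2Dsin2.
have pi0 := pi_gt0 R.
wlog le : a a' Ha Ha' ec es c1 / a' <= a.
  move=> H; case: (leP a' a) => [|/ltW] le; first exact: H.
  by apply/esym; apply: H => //; rewrite -cosN opprB.
have : sin ((a - a') / 2) = 0.
  have := cos_mulr2n ((a - a') / 2).
  have -> : (a - a') / 2 *+ 2 = a - a' by rewrite mulr2n -splitr.
  rewrite c1 cos2sin2 => h.
  by apply/eqP; rewrite -sqrf_eq0; apply/eqP; lra.
case: (eqVneq a a') => [//|ne] s0.
have : 0 < sin ((a - a') / 2).
  have : a' < a by rewrite lt_neqAle eq_sym ne.
  by move=> lt'; apply: sin_gt0_pi; lra.
by rewrite s0 ltxx.
Qed.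

Lemma nat_frac (m n : nat) (s s' : R) : 0 <= s < 1 -> 0 <= s' < 1 ->
  m%:R + s = n%:R + s' -> m = n /\ s = s'.
Proof.
wlog mn : m n s s' / (m <= n)%N.
  move=> H Hs Hs' e; case: (leqP m n) => [|/ltnW] le; first exact: H.
  by have [] := H _ _ _ _ le Hs' Hs (esym e).
move=> Hs Hs' e.
suff mn' : m = n by split => //; move: e; rewrite mn' => /addrI.
apply/eqP; rewrite eqn_leq mn /= leqNgt; apply/negP => lt.
have : (m.+1%:R <= n%:R :> R) by rewrite ler_nat.
by rewrite -natr1; lra.
Qed.

Lemma level_gt0 u : in_tree t u -> (0 < size (level t (size u)))%N.
Proof. by rewrite /in_tree; case: (level _ _). Qed.

Lemma angle_step_gt0 u : in_tree t u -> 0 < angle_step u.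
Proof.
move=> /level_gt0 h; rewrite /angle_step divr_gt0 ?ltr0n//.
by rewrite mulr_gt0// pi_gt0.
Qed.

Lemma angle_stepE u : in_tree t u ->
  (size (level t (size u)))%:R * angle_step u = 2 * pi.
Proof.
move=> /level_gt0 h; rewrite /angle_step mulrC divfK//.
by rewrite pnatr_eq0 -lt0n.
Qed.

Lemma angle_ge0 u : in_tree t u -> 0 <= angle u.
Proof. by move=> /angle_step_gt0/ltW h; rewrite mulr_ge0. Qed.

Lemma angle_le u : in_tree t u -> angle u + angle_step u <= 2 * pi.
Proof.
move=> ut; rewrite -(angle_stepE ut) /angle -[X in _ + X]mul1r -mulrDl natr1.
by rewrite ler_wpM2r ?(ltW (angle_step_gt0 _))// ler_nat index_mem.
Qed.

Lemma angle_bound u : in_tree t u -> 0 <= angle u < 2 * pi.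
Proof.
move=> ut; rewrite angle_ge0//=.
by have := angle_le ut; have := angle_step_gt0 ut; lra.
Qed.

Lemma angle_next u : in_tree t u -> exists b : bool,
  angle u + angle_step u
  = angle (next (level t (size u)) u) + b%:R * (2 * pi).
Proof.
move=> ut; have nt := in_tree_next ut.
have sz : size (next (level t (size u)) u) = size u.
  by rewrite (@level_size t (size u))// mem_next.
have st : angle_step (next (level t (size u)) u) = angle_step u.
  by rewrite /angle_step sz.
have -> : angle u + angle_step u
    = (index u (level t (size u))).+1%:R * angle_step u.
  by rewrite /angle -natr1 mulrDl mul1r.
rewrite /angle st sz.
have uq := level_uniq t (size u).
have := ut; rewrite /in_tree -index_mem => lti.
case: (ltnP (index u (level t (size u))).+1 (size (level t (size u)))) => h.
- exists false; rewrite mul0r addr0; congr (_%:R * _).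
  have -> : next (level t (size u)) u
     = nth [::] (level t (size u)) (index u (level t (size u))).+1.
    rewrite next_nth; move: ut; rewrite /in_tree => ->.
    case: (level t (size u)) h => [//|y p] h /=.
    by apply: set_nth_default.
  by rewrite index_uniq.
- exists true; rewrite mul1r -(angle_stepE ut).
  have E : (index u (level t (size u))).+1 = size (level t (size u)).
    by apply/eqP; rewrite eqn_leq h lti.
  have -> : index (next (level t (size u)) u) (level t (size u)) = 0%N.
    rewrite next_nth; move: ut; rewrite /in_tree => ->.
    case: (level t (size u)) h => [//|y p] h.
    by rewrite nth_default// /= eqxx.
  by rewrite mul0r add0r E.
Qed.

Lemma polar2pi (b : bool) r a : polar r (a + b%:R * (2 * pi)) = polar r a.
Proof.
case: b; last by rewrite mul0r addr0.
by rewrite mul1r mulr_natl /polar cosD2pi sinD2pi.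
Qed.

Lemma size_parent (v : nonroot) : (size (parent (val v))).+1 = size (val v).
Proof.
case: v => /= u /andP[_]; case: (lastP u) => [//|w i] _.
by rewrite parent_rcons size_rcons.
Qed.

Lemma causal_pos_inj : injective causal_pos.
Proof.
move=> u v /polar_inj[]//; try by apply/angle_bound/valP.
move=> /eqP; rewrite eqr_nat => /eqP suv H; apply/val_inj.
have := valP u; have := valP v; rewrite /= /in_tree -suv => vt ut.
case: H => [/eqP|].
  rewrite pnatr_eq0 size_eq0 => /eqP u0.
  by apply/esym; move: suv; rewrite u0 => /esym/size0nil ->.
have st : angle_step (val v) = angle_step (val u) by rewrite /angle_step suv.
rewrite /angle st -suv => /(mulIf (lt0r_neq0 (angle_step_gt0 (valP u)))) /eqP.
by rewrite eqr_nat => /eqP /(congr1 (nth [::] (level t (size (val u)))));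
  rewrite !nth_index.
Qed.

Lemma interp_lt (s a b a' b' : R) : 0 < s < 1 -> a <= a' -> b < b' ->
  (1 - s) * a + s * b < (1 - s) * a' + s * b'.
Proof. by nra. Qed.

Lemma tree_edge_bound (v : nonroot) s : 0 < s < 1 ->
  0 <= (1 - s) * angle (parent (val v)) + s * angle (val v) < 2 * pi.
Proof.
move=> s01; have vt := nonroot_in_tree v.
have /angle_bound := vt; have /angle_bound := in_tree_parent vt.
by nra.
Qed.

Lemma level_edge_bound (v : nonroot) s : 0 < s < 1 ->
  0 <= angle (val v) + s * angle_step (val v) < 2 * pi.
Proof.
move=> s01; have vt := nonroot_in_tree v.
by have := angle_ge0 vt; have := angle_le vt; have := angle_step_gt0 vt; nra.
Qed.

Lemma causal_curve_inj e e' s s' : 0 < s < 1 -> 0 < s' < 1 ->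
  causal_curve e s = causal_curve e' s' -> e = e' /\ s = s'.
Proof.
have fr (x : R) : 0 < x < 1 -> 0 <= x < 1 by lra.
move=> s01 s01'; case: e => v; case: e' => v'.
- move/polar_inj => []; try exact: tree_edge_bound.
  + by rewrite addr_ge0//; lra.
  + by rewrite addr_ge0//; lra.
  case/nat_frac; rewrite ?fr// => sz se H; rewrite -se in H *; split => //.
  case: H => [H|].
    have : 0 < (size (parent (val v)))%:R + s by rewrite ltr_wpDl//; lra.
    by rewrite H ltxx.
  have szv : size (val v) = size (val v') by rewrite -!size_parent sz.
  have vt := nonroot_in_tree v; have vt' := nonroot_in_tree v'.
  wlog idx : v v' sz szv vt vt' / (index (val v) (level t (size (val v)))
            <= index (val v') (level t (size (val v))))%N.
    move=> W E.
    case: (leqP (index (val v) (level t (size (val v))))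
                (index (val v') (level t (size (val v))))) => [|/ltnW] h.
      exact: W.
    by apply/esym; apply: W => //; rewrite -szv.
  move=> E; congr tree_edge; apply/val_inj.
  move: (vt) (vt'); rewrite /in_tree -szv => vl vl'.
  case: (ltngtP (index (val v) (level t (size (val v))))
                (index (val v') (level t (size (val v))))) idx => // [lt _|h _];
    last by move: h => /(congr1 (nth [::] (level t (size (val v)))));
            rewrite !nth_index.
  have st : angle_step (val v') = angle_step (val v).
    by rewrite /angle_step szv.
  have stp : angle_step (parent (val v')) = angle_step (parent (val v)).
    by rewrite /angle_step sz.
  have a1 : angle (val v) < angle (val v').
    by rewrite /angle st -szv ltr_pM2r ?angle_step_gt0// ltr_nat.
  have a2 : angle (parent (val v)) <= angle (parent (val v')).
    rewrite /angle stp -sz ler_pM2r ?(angle_step_gt0 (in_tree_parent vt))//.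
    rewrite ler_nat leqNgt; apply/negP => h.
    have := @index_parent t (size (parent (val v))) (val v') (val v).
    by rewrite size_parent => /(_ vl' vl h); rewrite ltnNge (ltnW lt).
  by have := interp_lt s01 a2 a1; rewrite E ltxx.
- move/polar_inj => [].
  + by rewrite addr_ge0//; lra.
  + by [].
  + exact: tree_edge_bound.
  + exact: level_edge_bound.
  rewrite -[RHS]addr0 => /nat_frac[]; rewrite ?(fr _ s01) ?(fr _ s01') ?lexx ?ltr01//.
  by move=> _ s0; move: s01; rewrite s0 ltxx.
- move/polar_inj => [].
  + by [].
  + by rewrite addr_ge0//; lra.
  + exact: level_edge_bound.
  + exact: tree_edge_bound.
  rewrite -[LHS]addr0 => /nat_frac[]; rewrite ?(fr _ s01) ?(fr _ s01') ?lexx ?ltr01//.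
  by move=> _ s0; move: s01'; rewrite -s0 ltxx.
- move/polar_inj => []//; try exact: level_edge_bound.
  move=> /eqP; rewrite eqr_nat => /eqP sz [/eqP|].
    by rewrite pnatr_eq0 -size_parent.
  have vt := nonroot_in_tree v; have vt' := nonroot_in_tree v'.
  have st : angle_step (val v') = angle_step (val v).
    by rewrite /angle_step sz.
  rewrite /angle st -!mulrDl => /(mulIf (lt0r_neq0 (angle_step_gt0 vt))).
  case/nat_frac; rewrite ?fr// => ix ->; split=> //; congr level_edge.
  apply/val_inj; move: vt vt' ix; rewrite /in_tree -sz => vl vl'.
  by move=> /(congr1 (nth [::] (level t (size (val v))))); rewrite !nth_index.
Qed.

Lemma causal_curve_pos e s v : 0 < s < 1 -> causal_curve e s <> causal_pos v.
Proof.
move=> s01; case: e => w.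
- move/polar_inj => [].
  + by rewrite addr_ge0//; lra.
  + by [].
  + exact: tree_edge_bound.
  + exact/angle_bound/valP.
  rewrite -[RHS]addr0 => /nat_frac[]; rewrite ?lexx ?ltr01//; first by lra.
  by move=> _ s0; move: s01; rewrite s0 ltxx.
- move/polar_inj => []//.
  + exact: level_edge_bound.
  + exact/angle_bound/valP.
  move=> /eqP; rewrite eqr_nat => /eqP sz [/eqP|].
    by rewrite pnatr_eq0 -size_parent.
  have wt := nonroot_in_tree w.
  have st : angle_step (val v) = angle_step (val w).
    by rewrite /angle_step sz.
  rewrite /angle st -mulrDl => /(mulIf (lt0r_neq0 (angle_step_gt0 wt))).
  rewrite -[RHS]addr0 => /nat_frac[]; rewrite ?lexx ?ltr01//; first by lra.
  by move=> _ s0; move: s01; rewrite s0 ltxx.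
Qed.

Lemma causal_curve0 e : causal_curve e 0 = causal_pos (causal_src e).
Proof.
by case: e => v /=; rewrite /causal_pos/= ?subr0 ?mul1r !mul0r !addr0.
Qed.

Lemma causal_curve1 e : causal_curve e 1 = causal_pos (causal_tgt e).
Proof.
case: e => v /=; rewrite /causal_pos/=.
  by rewrite subrr mul0r add0r mul1r natr1 size_parent.
have vt := nonroot_in_tree v.
have sz : size (next (level t (size (val v))) (val v)) = size (val v).
  by rewrite (@level_size t (size (val v)))// mem_next.
by have [b E] := angle_next vt; rewrite mul1r E polar2pi sz.
Qed.

Lemma continuous_polar (f g : R -> R) : continuous f -> continuous g ->
  continuous (fun s => polar (f s) (g s)).
Proof.
move=> cf cg s.
have hc : {for s, continuous (fun s => f s * cos (g s))}.
  apply: cvgM; first exact: cf.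
  by apply: continuous_comp; [exact: cg|exact: continuous_cos].
have hs : {for s, continuous (fun s => f s * sin (g s))}.
  apply: cvgM; first exact: cf.
  by apply: continuous_comp; [exact: cg|exact: continuous_sin].
exact: (cvg_pair hc hs).
Qed.

Lemma causal_curve_cts e : continuous (causal_curve e).
Proof.
case: e => v; apply: continuous_polar => s.
- by apply: cvgD; [exact: cvg_cst|exact: cvg_id].
- apply: cvgD; apply: cvgM; try exact: cvg_cst; last exact: cvg_id.
  by apply: cvgB; [exact: cvg_cst|exact: cvg_id].
- exact: cvg_cst.
- apply: cvgD; first exact: cvg_cst.
  by apply: cvgM; [exact: cvg_id|exact: cvg_cst].
Qed.

Definition causal_map : plane_map R :=
  PlaneMap (exist (in_tree t) [::] (in_tree_nil t))
    causal_curve_cts causal_curve0 causal_curve1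
    causal_pos_inj causal_curve_inj causal_curve_pos.

End causal_map.

(** * Galton-Watson trees *)

Section galton_watson.
Context d (Omega : measurableType d) (R : realType) (P : probability Omega R).

(** [X u] is the number of children of [u]; it is defined for every word [u],
    whether or not [u] is a vertex of the tree. *)
Variable X : seq nat -> {RV P >-> nat}.

Definition mutually_independent :=
  forall (J : seq (seq nat)) (B : seq nat -> set nat), uniq J ->
    P (\bigcap_(u in [set` J]) (X u @^-1` B u)) =
    (\prod_(u <- J) P (X u @^-1` B u))%E.

Definition galton_watson (mu : probability nat R) :=
  (forall u (B : set nat), distribution P (X u) B = mu B) /\
  mutually_independent.

Definition random_tree (w : Omega) : plane_tree := fun u => X u w.

Definition survival : set Omega := [set w | survives (random_tree w)].

Lemma measurable_children us l :
  measurable [set w | [seq random_tree w u | u <- us] = l].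
Proof.
elim: us l => [|u us IH] [|k l].
- by rewrite (_ : [set _ | _] = setT)//; apply/seteqP; split.
- by rewrite (_ : [set _ | _] = set0)//; apply/seteqP; split.
- by rewrite (_ : [set _ | _] = set0)//; apply/seteqP; split.
rewrite (_ : [set _ | _] = X u @^-1` [set k] `&`
    [set w | [seq random_tree w u | u <- us] = l]).
  by apply: measurableI => //; exact: measurable_funPTI.
by apply/seteqP; split => [w /= []|w [/= <- <-]].
Qed.

Lemma measurable_level h s :
  measurable [set w | level (random_tree w) h = s].
Proof.
elim: h s => [|h IH] s.
  case: (eqVneq s [:: [::]]) => [->|/eqP ne].
    by rewrite (_ : [set _ | _] = setT)//; apply/seteqP; split.
  rewrite (_ : [set _ | _] = set0)//; apply/seteqP; split => // w /= e.
  by apply: ne; rewrite -e.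
pose F (us : seq (seq nat)) (l : seq nat) :=
  flatten [seq [seq rcons x.1 i | i <- iota 0 x.2] | x <- zip us l].
have levelE w : level (random_tree w) h.+1 =
    F (level (random_tree w) h)
      [seq random_tree w u | u <- level (random_tree w) h].
  by rewrite /F /=; elim: (level _ h) => //= u us ->.
rewrite (_ : [set _ | _] = \bigcup_(p : seq (seq nat) * seq nat)
    ([set w | level (random_tree w) h = p.1] `&`
     [set w | [seq random_tree w u | u <- p.1] = p.2] `&`
     [set _ | F p.1 p.2 = s])).
  apply: countable_bigcupT_measurable => // -[us l] /=.
  apply: measurableI; last first.
    case: (pselect (F us l = s)) => [e|ne].
      by rewrite (_ : [set _ | _] = setT)//; apply/seteqP; split.
    by rewrite (_ : [set _ | _] = set0)//; apply/seteqP; split.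
  by apply: measurableI; [exact: IH|exact: measurable_children].
apply/seteqP; split => w.
  move=> e; exists (level (random_tree w) h,
    [seq random_tree w u | u <- level (random_tree w) h]) => //=.
  by rewrite -levelE.
by move=> [[us l] _ /= [[e1 e2] e3]]; rewrite -e3 -e2 -e1 -levelE.
Qed.

Lemma measurable_survival : measurable survival.
Proof.
rewrite (_ : survival = \bigcap_h
    ~` [set w | level (random_tree w) h = [::]]).
  apply: bigcap_measurableType => h _; exact/measurableC/measurable_level.
apply/seteqP; split => w.
  by move=> S h _ /= e; have := S h; rewrite e.
by move=> S h; apply/eqP; exact: S.
Qed.

(** The conditional probability given [survival]. (The second argument of
    [mnormalize] is a default for the case of an event of probability [0].) *)
Definition cond_survival : probability Omega R :=
  mnormalize (mrestr P measurable_survival) P.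

End galton_watson.

(* Main.v *)
Require Import Defs.
From HB Require Import structures.
From mathcomp Require Import all_boot all_order all_algebra.
From mathcomp Require Import all_classical all_reals all_analysis.
From mathcomp Require Import zify ring lra.

(** Call a vertex surviving if its subtree is infinite, and let [Z] count the
    surviving vertices at a given height. Consider a path of the causal map
    between two rays of the tree, and let [k] be its minimal height. Projecting the
    path to its ancestors of height [k], it has to go around the cycle of the
    surviving vertices of height [k] from one ray to the other; it cannot jump over a
    surviving vertex, so each of these costs a horizontal step. Hence a path from
    height [i] on the first ray to height [j] on the second one has length at least
    [i + j - 2 k] plus the number of surviving vertices of height [k] on one of the
    two sides. If these numbers exceed [2 k] for large [k], then such paths are
    shorter than [i + j] by at most a constant, and those of length at most [i + j]
    must come close to the root.

    Bi-infinite geodesics follow by gluing two such rays. For hyperbolicity take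
    four such rays: a triangle surrounding the root meets all of them, as each is
    connected and unbounded, so one of its three sides meets two of them.

    To obtain the rays it suffices that almost surely every surviving vertex has a
    number of surviving descendants that grows at least linearly: the rate becomes
    arbitrarily large by starting from many surviving vertices. Passing to the
    first surviving child of the root preserves the law of the tree given survival,
    and with positive probability another child survives too; so
    [P (0 < Z_(k+1) <= m) <= (1 - b) P (0 < Z_k <= m) + b P (0 < Z_k <= m - 1)] for
    some [b > 0], which bounds this probability by [(1 - b / 2) ^ k * 2 ^ m], and
    Borel-Cantelli applies along [k = J m]. *)

Set Implicit Arguments.
Unset Strict Implicit.
Unset Printing Implicit Defensive.

Import Order.TTheory GRing.Theory Num.Theory.
Import numFieldNormedType.Exports.

Local Open Scope classical_set_scope.
Local Open Scope ring_scope.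

(** * Subtrees and rays *)

Lemma mem_neq_nil (T : eqType) (s : seq T) : s != [::] -> exists x, x \in s.
Proof. by case: s => // x s _; exists x; rewrite mem_head. Qed.

Section subtrees.
Local Open Scope nat_scope.
Implicit Types (t : plane_tree) (u v w : seq nat).

Definition subtree t v : plane_tree := fun w => t (v ++ w).

Lemma subtree_cat t v w : subtree (subtree t v) w = subtree t (v ++ w).
Proof. by apply/funext => x; rewrite /subtree catA. Qed.

Lemma level_add t h n : level t (h + n) =
  flatten [seq [seq v ++ w | w <- level (subtree t v) n] | v <- level t h].
Proof.
elim: n => [|n IH].
  rewrite addn0 /=; elim: (level t h) => //= v s {1}->.
  by rewrite cats0.
rewrite addnS /= IH; elim: (level t h) => //= v s IHs.
rewrite map_cat flatten_cat IHs; congr (_ ++ _).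
elim: (level (subtree t v) n) => //= w r ->.
rewrite map_cat -map_comp; congr (_ ++ _).
by apply: eq_map => i /=; rewrite rcons_cat.
Qed.

Lemma level_1 t : level t 1 = [seq [:: i] | i <- iota 0 (t [::])].
Proof. by rewrite /= cats0. Qed.

Lemma mem_level_cat t h n v w : v \in level t h ->
  w \in level (subtree t v) n -> v ++ w \in level t (h + n).
Proof.
move=> vh wn; rewrite level_add; apply/flatten_mapP; exists v => //.
by rewrite map_f.
Qed.

Lemma level_split t h n u : u \in level t (h + n) ->
  take h u \in level t h /\ drop h u \in level (subtree t (take h u)) n.
Proof.
rewrite level_add => /flatten_mapP[v vh /mapP[w wn ->]].
have sv := level_size vh.
by rewrite -sv take_size_cat// drop_size_cat// sv.
Qed.

Lemma level_take t h n u : u \in level t (h + n) -> take h u \in level t h.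
Proof. by move/level_split => []. Qed.

Lemma level_index_take t k n u v :
  u \in level t (k + n) -> v \in level t (k + n) ->
  index (take k u) (level t k) < index (take k v) (level t k) ->
  index u (level t (k + n)) < index v (level t (k + n)).
Proof.
elim: n u v => [|n IH] u v.
  rewrite addn0 => uk vk.
  by rewrite !take_oversize ?(level_size uk) ?(level_size vk).
rewrite addnS => uk vk H; apply: index_parent => //.
have take_par w : w \in level t (k + n).+1 -> take k (parent w) = take k w.
  by move=> wk; rewrite /parent (level_size wk) take_takel// leq_addr.
by apply: IH; rewrite ?take_par//; exact: level_parent.
Qed.

Lemma level_nil_add t h n : level t h = [::] -> level t (h + n) = [::].
Proof. by rewrite level_add => ->. Qed.

Lemma survives_up t w m : w \in level t m -> survives (subtree t w) ->
  survives t.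
Proof.
move=> wm sw h; apply/eqP => e.
have [x xh] := mem_neq_nil (sw h).
have := mem_level_cat wm xh.
by rewrite addnC (level_nil_add _ e).
Qed.

(** The step of König's lemma: if the finitely many subtrees of the children all died out, the tree
    would be extinct one level above the maximum [h] of their extinction heights. *)
Lemma survives_down t : survives t ->
  exists2 i, i < t [::] & survives (subtree t [:: i]).
Proof.
move=> st; apply: contrapT => H.
have /choice[f Hf] : forall i, exists h, i < t [::] ->
    level (subtree t [:: i]) h = [::].
  move=> i; case: (ltnP i (t [::])) => it; last by exists 0.
  have : ~ survives (subtree t [:: i]) by move=> si; apply: H; exists i.
  by move=> /existsNP[h /negP/negPn/eqP]; exists h.
pose h := \max_(i < t [::]) f i.
have [x] := mem_neq_nil (st (1 + h)); rewrite level_add level_1.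
case/flatten_mapP => y /mapP[i]; rewrite mem_iota add0n => /= it -> /mapP[w].
have fh : f i <= h by rewrite (leq_bigmax (Ordinal it)).
by rewrite -(subnKC fh) level_nil_add// Hf.
Qed.

Lemma survives_rcons t v : survives (subtree t v) ->
  exists i, i < t v /\ survives (subtree t (rcons v i)).
Proof.
move=> /survives_down[i it si]; exists i; split.
  by rewrite /subtree cats0 in it.
by rewrite -cats1 -subtree_cat.
Qed.

Lemma mem_level_rcons t h v i : v \in level t h -> i < t v ->
  rcons v i \in level t h.+1.
Proof.
move=> vh iv; apply/flatten_mapP; exists v => //.
by apply: map_f; rewrite mem_iota.
Qed.

Definition surviving t : pred (seq nat) := fun v => `[< survives (subtree t v) >].

Lemma surviving_subtree t v w : surviving (subtree t v) w = surviving t (v ++ w).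
Proof. by rewrite /surviving subtree_cat. Qed.

Definition nsurv n t := count (surviving t) (level t n).

(** Survivors are grouped by their ancestor of height [h]. The predicate [Q] on ancestors makes it
    possible to count the descendants of an interval of them. *)
Lemma count_surviving_add t h n (Q : pred (seq nat)) :
  count (fun u => surviving t u && Q (take h u)) (level t (h + n)) =
  \sum_(v <- level t h | Q v) nsurv n (subtree t v).
Proof.
rewrite level_add count_flatten sumnE big_map big_map [RHS]big_mkcond /=.
apply: eq_big_seq => v vh; rewrite count_map /nsurv.
case: ifP => Qv.
  apply: eq_count => w /=.
  by rewrite -(level_size vh) take_size_cat// Qv andbT surviving_subtree.
apply/eqP; rewrite eqn0Ngt -has_count; apply/hasPn => w _ /=.
by rewrite -(level_size vh) take_size_cat// Qv andbF.
Qed.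

Lemma nsurv_add t h n :
  nsurv (h + n) t = \sum_(v <- level t h) nsurv n (subtree t v).
Proof.
rewrite -(count_surviving_add t h n predT).
by apply: eq_count => u; rewrite /= andbT.
Qed.

Lemma nsurvS t n : nsurv n.+1 t = \sum_(i < t [::]) nsurv n (subtree t [:: i : nat]).
Proof.
rewrite -[n.+1]/(1 + n) nsurv_add level_1 big_map.
by rewrite -(big_mkord predT (fun i => nsurv n (subtree t [:: i]))) /index_iota subn0.
Qed.

Lemma nsurv0 t : nsurv 0 t = surviving t [::].
Proof. by rewrite /nsurv /= addn0. Qed.

Lemma nsurv_gt0 t n : reflect (survives t) (0 < nsurv n t).
Proof.
apply: (iffP idP) => [|st].
  by rewrite -has_count => /hasP[w wn /asboolP]; exact: survives_up wn.
elim: n t st => [|n IH] t st; first by rewrite nsurv0 lt0b /surviving asboolE.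
have [i it si] := survives_down st.
rewrite nsurvS (bigD1 (Ordinal it))//=.
by rewrite ltn_addr// IH.
Qed.

End subtrees.

Section rays.
Local Open Scope nat_scope.
Variable t : plane_tree.
Implicit Types (u v w : seq nat) (g : nat -> seq nat).

Definition ray g := forall n,
  [/\ g n \in level t n, surviving t (g n) & parent (g n.+1) = g n].

Lemma ray_size g n : ray g -> size (g n) = n.
Proof. by move=> /(_ n)[/level_size]. Qed.

Lemma ray_take g k n : ray g -> k <= n -> take k (g n) = g k.
Proof.
move=> rg; elim: n => [|n IH].
  by rewrite leqn0 => /eqP ->; rewrite take_oversize// (ray_size _ rg).
rewrite leq_eqVlt => /predU1P[->|]; first by rewrite take_oversize// (ray_size _ rg).
rewrite ltnS => kn; rewrite -IH//.
have [_ _ <-] := rg n.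
by rewrite /parent (ray_size _ rg) take_takel.
Qed.

Lemma ray_through h v : v \in level t h -> surviving t v ->
  exists2 g, ray g & g h = v.
Proof.
move=> vh /asboolP sv.
have /choice[c Hc] : forall u, exists i, survives (subtree t u) ->
    i < t u /\ survives (subtree t (rcons u i)).
  move=> u; case: (pselect (survives (subtree t u))) => [|nu].
    by move=> /survives_rcons[i]; exists i.
  by exists 0.
pose f n := iter n (fun u => rcons u (c u)) v.
have fP n : f n \in level t (n + h) /\ survives (subtree t (f n)).
  elim: n => [//|n [IH1 /Hc[IH2 IH3]]]; split => //.
  by rewrite addSn /=; apply: mem_level_rcons.
have fsz n : size (f n) = n + h by apply: (@level_size t); case: (fP n).
have ftake m n k : k <= m + h -> take k (f (m + n)) = take k (f m).
  move=> km; elim: n => [|n IH]; first by rewrite addn0.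
  by rewrite addnS /= -cats1 takel_cat// fsz (leq_trans km)// leq_add2r leq_addr.
(* [f n] has length [n + h], so its prefix of length [n] is an ancestor of [v] for [n <= h] and a
   vertex of the descending line from [v] afterwards. *)
exists (fun n => take n (f n)); last first.
  by rewrite (@ftake 0)// take_oversize// (level_size vh).
move=> n; have [fn sfn] := fP n; split.
- exact: level_take fn.
- have [_ dn] := level_split fn.
  by apply/asboolP/(survives_up dn); rewrite subtree_cat cat_take_drop.
- rewrite /parent size_takel ?fsz ?leq_addr//= take_takel//.
  by rewrite -cats1 takel_cat// fsz leq_addr.
Qed.

End rays.

(** * Paths and geodesics *)

Section path_theory.
Context {R : realType} {M : plane_map R}.
Implicit Types (x y z : vertex M) (p q : seq (@dart R M)).

Lemma is_path_cat x p q y :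
  is_path x (p ++ q) y <-> exists2 z, is_path x p z & is_path z q y.
Proof.
elim: p x => [|a p IH] x /=; first by split=> [|[z <-]//]; exists x.
split=> [[ax /IH[z]]|[z [ax pz] zy]]; first by exists z.
by split => //; apply/IH; exists z.
Qed.

Lemma path_vertices_start x p : path_vertices x p x.
Proof. by case: p => [|a p] /=; [|left]. Qed.

Lemma path_vertices_end x p y : is_path x p y -> path_vertices x p y.
Proof.
by elim: p x => [x /= ->//|a p IH] x /= [_ /IH]; right.
Qed.

Lemma path_vertices_split x p y z : is_path x p y -> path_vertices x p z ->
  exists p1 p2, [/\ p = p1 ++ p2, is_path x p1 z & is_path z p2 y].
Proof.
elim: p x => [x /= <- ->|a p IH x /= [ax ay] [->|/(IH _ ay)[p1 [p2 [-> p1z zy]]]]].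
- by exists [::], [::].
- by exists [::], (a :: p).
- by exists (a :: p1), p2.
Qed.

Lemma path_vertices_cat x p q y z : is_path x p y ->
  path_vertices x (p ++ q) z <-> path_vertices x p z \/ path_vertices y q z.
Proof.
elim: p x => [x /= ->|a p IH x /= [_ /IH E]].
  by split=> [|[->|//]]; [right|exact: path_vertices_start].
split=> [[->|/E[]]|[[->|h]|h]]; try tauto; by [left; left|left; right|right; apply/E; tauto].
Qed.

Definition rev_dart (a : @dart R M) : dart := (a.1, ~~ a.2).

Lemma rev_dart_src a : dart_src (rev_dart a) = dart_tgt a.
Proof. by case: a => e []. Qed.

Lemma rev_dart_tgt a : dart_tgt (rev_dart a) = dart_src a.
Proof. by case: a => e []. Qed.

Lemma is_path_rev x p y : is_path x p y -> is_path y (rev (map rev_dart p)) x.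
Proof.
elim: p x => [x //=|a p IH x /= [ax /IH py]].
rewrite rev_cons -cats1; apply/is_path_cat; exists (dart_tgt a) => //=.
by rewrite rev_dart_src rev_dart_tgt.
Qed.

(** This is distance at most [n], stated in [nat] so that the path arguments avoid the infimum in
    [\bar R]. *)
Definition linked (n : nat) x y := exists2 p, is_path x p y & (size p <= n)%N.

Lemma linked0 x : linked 0 x x.
Proof. by exists [::]. Qed.

Lemma linked_sym n x y : linked n x y -> linked n y x.
Proof.
move=> [p /is_path_rev xy pn]; exists (rev (map rev_dart p)) => //.
by rewrite size_rev size_map.
Qed.

Lemma linked_trans m n x y z :
  linked m x y -> linked n y z -> linked (m + n) x z.
Proof.
move=> [p xy pm] [q yz qn]; exists (p ++ q); first by apply/is_path_cat; exists y.
by rewrite size_cat leq_add.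
Qed.

Lemma linked_le m n x y : (m <= n)%N -> linked m x y -> linked n x y.
Proof. by move=> mn [p xy pm]; exists p => //; exact: leq_trans mn. Qed.

Lemma graph_dist_le n x y : linked n x y -> (graph_dist x y <= n%:R%:E)%E.
Proof.
move=> [p xy pn]; apply: (@le_trans _ _ (size p)%:R%:E).
  by apply: ereal_inf_lbound; exists p.
by rewrite lee_fin ler_nat.
Qed.

Lemma graph_dist_eq n x y : linked n x y ->
  (forall m, linked m x y -> n <= m)%N -> graph_dist x y = n%:R%:E.
Proof.
move=> ln lmin; apply/eqP; rewrite eq_le graph_dist_le//=.
apply: le_ereal_inf_tmp => _ [p xy <-]; rewrite lee_fin ler_nat.
by apply: lmin; exists p.
Qed.

Lemma geodesic_min x p y n : geodesic x p y -> linked n x y -> (size p <= n)%N.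
Proof.
by move=> [_ e] /graph_dist_le; rewrite e lee_fin ler_nat.
Qed.

(** A shorter connection between [z] and [z'] could replace the middle piece and would shorten the
    whole geodesic. *)
Lemma geodesic_mid x p1 p2 p3 z z' y n : geodesic x (p1 ++ p2 ++ p3) y ->
  is_path x p1 z -> is_path z p2 z' -> is_path z' p3 y ->
  linked n z z' -> (size p2 <= n)%N.
Proof.
move=> g xz zz' z'y lzz'.
have l1 : linked (size p1) x z by exists p1.
have l3 : linked (size p3) z' y by exists p3.
have := geodesic_min g (linked_trans l1 (linked_trans lzz' l3)).
by rewrite !size_cat leq_add2l leq_add2r.
Qed.

End path_theory.

Section bi_infinite.
Context {R : realType} {M : plane_map R}.

(** Only pairs of far endpoints have to be checked: a shortcut between two points in between would
    extend to a shortcut between the endpoints. *)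
Lemma bi_infinite_geodesicP (g : int -> vertex M) :
  (forall n : int, linked 1 (g n) (g (n + 1))) ->
  (forall n : nat, exists a b : int, [/\ a <= - n%:Z, n%:Z <= b &
      forall m, linked m (g a) (g b) -> b - a <= m%:Z]) ->
  bi_infinite_geodesic g.
Proof.
move=> step far.
have up (n : int) (m : nat) : linked m (g n) (g (n + m%:Z)).
  elim: m => [|m IH]; first by rewrite addr0; exact: linked0.
  by rewrite -addn1 PoszD addrA; exact: linked_trans IH (step _).
have dist (i : int) (m : nat) : graph_dist (g i) (g (i + m%:Z)) = m%:R%:E.
  apply: graph_dist_eq; first exact: up.
  move=> m' lm'.
  (* The bound [absz i + m] ensures that both [i] and [i + m] lie between [a] and [b]. *)
  have [a [b [ai ib min]]] := far (absz i + m)%N.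
  have := up a (absz (i - a)%R); have -> : a + (absz (i - a)%R)%:Z = i by lia.
  have := up (i + m%:Z) (absz (b - (i + m%:Z))%R).
  have -> : i + m%:Z + (absz (b - (i + m%:Z))%R)%:Z = b by lia.
  by move=> l3 l1; have := min _ (linked_trans l1 (linked_trans lm' l3)); lia.
have dist' (i : int) (m : nat) : graph_dist (g (i + m%:Z)) (g i) = m%:R%:E.
  apply: graph_dist_eq => [|m' /linked_sym/graph_dist_le].
    exact/linked_sym/up.
  by rewrite dist lee_fin ler_nat.
move=> i j; case: (lerP j i) => ij.
  have {1}-> : i = j + (absz (i - j)%R)%:Z by lia.
  by rewrite dist'; congr (_%:E); rewrite -[LHS]/(((absz (i - j)%R)%:Z)%:~R); congr (_%:~R); lia.
have {1}-> : j = i + (absz (i - j)%R)%:Z by lia.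
by rewrite dist; congr (_%:E); rewrite -[LHS]/(((absz (i - j)%R)%:Z)%:~R); congr (_%:~R); lia.
Qed.

End bi_infinite.

(** * Horizontal steps of a path *)

Lemma index_next (T : eqType) (s : seq T) x : uniq s -> x \in s ->
  index (next s x) s =
  if ((index x s).+1 < size s)%N then (index x s).+1 else 0%N.
Proof.
case: s => // y s us xs; rewrite next_nth xs; case: ifPn => [lt|].
  by rewrite -[nth y s _]/(nth y (y :: s) (index x (y :: s)).+1) index_uniq.
by rewrite -leqNgt => ge; rewrite nth_default ?index_head.
Qed.

(* Truncated subtraction makes this the absolute difference. *)
Definition gap (m n : nat) := ((m - n) + (n - m))%N.

Lemma gapnn m : gap m m = 0%N.
Proof. by rewrite /gap; lia. Qed.

Lemma gapnS m : gap m m.+1 = 1%N.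
Proof. by rewrite /gap; lia. Qed.

Section ranks.
Local Open Scope nat_scope.
Variables (t : plane_tree) (k : nat).
Implicit Types (u v w : seq nat).

(** The position of the height-[k] ancestor of [v] in the cycle of surviving vertices. That ancestor
    need not survive itself. *)
Definition rank v := count (fun u => surviving t u &&
  (index u (level t k) <= index (take k v) (level t k))) (level t k).

Lemma rank_le v : rank v <= nsurv k t.
Proof. by apply: sub_count => u /andP[]. Qed.

Lemma surviving_descendant n u : u \in level t k -> surviving t u ->
  exists2 w, w \in level t (k + n) & take k w = u.
Proof.
move=> uk /asboolP /(_ n)/mem_neq_nil[w wn]; exists (u ++ w).
  exact: mem_level_cat.
by rewrite -(level_size uk) take_size_cat.
Qed.

Lemma level_index_inj h u v : u \in level t h ->
  index u (level t h) = index v (level t h) -> u = v.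
Proof.
move=> uh e; have vh : v \in level t h by rewrite -index_mem -e index_mem.
by rewrite -(nth_index [::] uh) e nth_index.
Qed.

(* A surviving vertex of level [k] has descendants at every level above, so
   two consecutive vertices of such a level cannot have an ancestor of level [k]
   strictly between their own ones which survives. *)
Lemma rank_adjacent n v w : v \in level t (k + n) -> w \in level t (k + n) ->
  index w (level t (k + n)) = (index v (level t (k + n))).+1 ->
  rank v <= rank w <= (rank v).+1.
Proof.
move=> vk wk vw.
have anc_le : index (take k v) (level t k) <= index (take k w) (level t k).
  by rewrite leqNgt; apply/negP => /(level_index_take wk vk); rewrite vw; lia.
apply/andP; split.
  by apply: sub_count => u /= /andP[-> /leq_trans]; exact.
rewrite -addn1.
(* The only survivor that can be counted for [w] and not for [v] is the ancestor of [w]. *)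
have <- : count_mem (take k w) (level t k) = 1.
  by rewrite (count_uniq_mem _ (level_uniq _ _)) (level_take wk).
rewrite /rank -count_predUI; apply: leq_trans (leq_addr _ _).
rewrite -!size_filter; apply: uniq_leq_size.
  exact/filter_uniq/level_uniq.
move=> u; rewrite !mem_filter /= => /andP[/andP[su uw] uk]; rewrite uk su /= andbT.
case: leqP => //= vu; apply/eqP; apply: (level_index_inj uk).
apply/eqP; rewrite eqn_leq uw leqNgt; apply/negP => uw'.
have [x xk ux] := surviving_descendant n uk su.
have : index v (level t (k + n)) < index x (level t (k + n)).
  by apply: level_index_take => //; rewrite ux.
have : index x (level t (k + n)) < index w (level t (k + n)).
  by apply: level_index_take => //; rewrite ux.
by rewrite vw; lia.
Qed.

(** A survivor to the right of the ancestor of [v] would have a descendant to the right of the last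
    vertex of the level. *)
Lemma rank_last n v : v \in level t (k + n) ->
  size (level t (k + n)) <= (index v (level t (k + n))).+1 ->
  rank v = nsurv k t.
Proof.
move=> vk last; apply/eqP; rewrite eqn_leq rank_le /= /rank /nsurv.
rewrite -!size_filter; apply: uniq_leq_size; first exact/filter_uniq/level_uniq.
move=> u; rewrite !mem_filter /= => /andP[su uk]; rewrite uk su /= andbT.
rewrite leqNgt; apply/negP => vu.
have [x xk ux] := surviving_descendant n uk su.
have : index v (level t (k + n)) < index x (level t (k + n)).
  by apply: level_index_take => //; rewrite ux.
by move=> /(leq_trans last); rewrite leqNgt index_mem xk.
Qed.

Lemma rank_first n v : v \in level t (k + n) ->
  index v (level t (k + n)) = 0 -> rank v <= 1.
Proof.
move=> vk v0.
have <- : count_mem (take k v) (level t k) = 1.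
  by rewrite (count_uniq_mem _ (level_uniq _ _)) (level_take vk).
rewrite /rank -!size_filter; apply: uniq_leq_size; first exact/filter_uniq/level_uniq.
move=> u; rewrite !mem_filter /= => /andP[/andP[su uv] uk]; rewrite uk andbT.
apply/eqP/(level_index_inj uk)/eqP; rewrite eqn_leq uv leqNgt; apply/negP => vu.
have [x xk ux] := surviving_descendant n uk su.
have : index x (level t (k + n)) < index v (level t (k + n)).
  by apply: level_index_take => //; rewrite ux.
by rewrite v0.
Qed.

(* The distance from [r] to [rank v] around the cycle of surviving vertices. *)
Definition rank_dist r v :=
  let d := gap r (rank v) in minn d (nsurv k t - d).


(** A horizontal step moves the rank by at most one around the cycle. This includes the edge closing
    a level: there the rank passes from [nsurv k t], which is the same point of the cycle as [0], to
    at most [1]. *)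
Lemma rank_dist_next n r v : r <= nsurv k t -> v \in level t (k + n) ->
  gap (rank_dist r v) (rank_dist r (next (level t (k + n)) v)) <= 1.
Proof.
move=> rN vk; have nk : next (level t (k + n)) v \in level t (k + n) by rewrite mem_next.
have := index_next (level_uniq t _) vk; case: ltnP => [_ i|last i].
  have := rank_adjacent vk nk i; have := rank_le (next (level t (k + n)) v).
  by move: rN; rewrite /rank_dist /gap; lia.
have := rank_first nk i; have := rank_last vk last.
have := rank_le (next (level t (k + n)) v).
by move: rN; rewrite /rank_dist /gap; lia.
Qed.

Lemma rank_dist_parent r v : k < size v ->
  rank_dist r (parent v) = rank_dist r v.
Proof.
by move=> kv; rewrite /rank_dist /rank /parent take_takel// -ltnS prednK//; lia.
Qed.

End ranks.

(** * Length bounds for paths of the causal map *)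

Section causal_paths.
Variables (R : realType) (t : plane_tree).
Local Notation M := (causal_map R t).
Implicit Types (x y z : vertex M) (p : seq (@dart R M)).

Definition height x := size (val x : seq nat).

(** A tree edge changes the height by one and keeps the ancestor of height [k]; a level edge keeps
    the height and moves the rank by at most one. So an edge pays for only one of the two gaps. *)
Lemma causal_edge_bound k r (e : edge M) : (r <= nsurv k t)%N ->
  (k <= height (edge_src e))%N -> (k <= height (edge_tgt e))%N ->
  (gap (height (edge_src e)) (height (edge_tgt e)) +
   gap (rank_dist t k r (val (edge_src e)))
         (rank_dist t k r (val (edge_tgt e))) <= 1)%N.
Proof.
move=> rN; case: e => v; rewrite /height /=.
  move=> kp _; have sv : (size (parent (sval v))).+1 = size (sval v) := size_parent v.
  rewrite rank_dist_parent -sv; last by rewrite ltnS.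
  by rewrite gapnS gapnn.
move=> kv _; have vt := nonroot_in_tree v.
rewrite (@level_size t (size (val v)) (next _ _)) ?mem_next//.
have := @rank_dist_next t k (size (val v) - k) r (val v) rN.
by rewrite subnKC// => /(_ vt) H; rewrite gapnn.
Qed.

Lemma gapC m n : gap m n = gap n m.
Proof. by rewrite /gap addnC. Qed.

Lemma gap_add m1 m2 m3 n1 n2 n3 a b : (gap m1 m2 + gap n1 n2 <= a)%N ->
  (gap m2 m3 + gap n2 n3 <= b)%N -> (gap m1 m3 + gap n1 n3 <= a + b)%N.
Proof. by rewrite /gap; lia. Qed.

Lemma causal_path_bound k r x p y : (r <= nsurv k t)%N -> is_path x p y ->
  (forall z, path_vertices x p z -> k <= height z)%N ->
  (gap (height x) (height y) +
   gap (rank_dist t k r (val x)) (rank_dist t k r (val y)) <= size p)%N.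
Proof.
move=> rN; elim: p x => [x /= -> _|[e b] p IH x]; first by rewrite !gapnn.
rewrite [is_path _ _ _]/= => -[<- ay] H; rewrite /= -add1n.
apply: (gap_add _ (IH _ ay _)); last by move=> z pz; apply: H; right.
have ks : (k <= height (dart_src (e, b)))%N by apply: H; left.
have kt : (k <= height (dart_tgt (e, b)))%N.
  by apply: H; right; exact: path_vertices_start.
case: b ks kt {ay H} => ks kt; first exact: causal_edge_bound.
by rewrite gapC [X in (_ + X)%N]gapC; exact: causal_edge_bound.
Qed.

Lemma lowest_vertex x p : exists2 z, path_vertices x p z &
  forall z', path_vertices x p z' -> (height z <= height z')%N.
Proof.
elim: p x => [x|a p IH x] /=; first by exists x => // _ ->.
have [z pz zmin] := IH (dart_tgt a).
case: (leqP (height x) (height z)) => xz.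
  exists x; first by left.
  by move=> z' [->//|/zmin]; exact: leq_trans.
by exists z; [right|move=> z' [->|/zmin//]; exact: ltnW].
Qed.

Definition separation (ga gb : nat -> seq nat) k :=
  rank_dist t k (rank t k (ga k)) (gb k).

(** The path is cut at a lowest vertex [z], of height [k]. The two halves pay [i - k] and [j - k]
    vertically and together at least the separation at height [k] horizontally. *)
Lemma rays_path_bound ga gb i j x p y : ray t ga -> ray t gb ->
  is_path x p y -> val x = ga i -> val y = gb j ->
  exists2 z, path_vertices x p z &
    (i + j + separation ga gb (height z) <= size p + (height z).*2)%N.
Proof.
move=> ra rb xy xi yj; have [z pz zmin] := lowest_vertex x p; exists z => //.
have hx : height x = i by rewrite /height xi (ray_size _ ra).
have hy : height y = j by rewrite /height yj (ray_size _ rb).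
have zi := zmin _ (path_vertices_start x p); rewrite hx in zi.
have zj := zmin _ (path_vertices_end xy); rewrite hy in zj.
set k := height z in zmin zi zj *.
have [p1 [p2 [pE xz zy]]] := path_vertices_split xy pz.
have rank_ray g n : ray t g -> (k <= n)%N -> rank t k (g n) = rank t k (g k).
  by move=> rg kn; rewrite /rank !(ray_take rg).
(* Both halves measure ranks from the first ray, so the horizontal distance is [0] at [x] and the
   separation at [y]. *)
pose r := rank t k (ga k).
have rN : (r <= nsurv k t)%N by exact: rank_le.
have b1 : (i - k + rank_dist t k r (val z) <= size p1)%N.
  have /(causal_path_bound rN xz) : forall z', path_vertices x p1 z' -> (k <= height z')%N.
    by move=> z' z'1; apply: zmin; rewrite pE; apply/(path_vertices_cat _ _ xz); left.
  have -> : rank_dist t k r (val x) = 0%N.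
    by rewrite xi /rank_dist rank_ray// -/r gapnn /= min0n.
  by rewrite hx -/k /gap; lia.
have b2 : (j - k + separation ga gb k <= size p2 + rank_dist t k r (val z))%N.
  have /(causal_path_bound rN zy) : forall z', path_vertices z p2 z' -> (k <= height z')%N.
    by move=> z' z'2; apply: zmin; rewrite pE; apply/(path_vertices_cat _ _ xz); right.
  have -> : rank_dist t k r (val y) = separation ga gb k.
    by rewrite yj /separation /rank_dist /= (rank_ray gb j).
  by rewrite hy -/k /gap; lia.
by rewrite pE size_cat -addnn; move: zi zj b1 b2; lia.
Qed.

End causal_paths.

(** * Separated rays *)

Lemma index_filter_lt (T : eqType) (P : pred T) (s : seq T) x y : P x -> P y ->
  (index x [seq z <- s | P z] < index y [seq z <- s | P z])%N =
  (index x s < index y s)%N.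
Proof.
move=> Px Py; elim: s => //= z s IH.
case: ifP => Pz /=; last first.
  have -> : (z == x) = false by apply: contraFF Pz => /eqP ->.
  have -> : (z == y) = false by apply: contraFF Pz => /eqP ->.
  by rewrite ltnS.
by case: (z == x); case: (z == y); rewrite ?ltnS.
Qed.

Lemma count_disjoint_le (T : eqType) (P1 P2 P3 : pred T) (s : seq T) :
  {in s, forall x, P1 x -> P2 x -> false} ->
  {in s, forall x, P1 x -> P3 x} -> {in s, forall x, P2 x -> P3 x} ->
  (count P1 s + count P2 s <= count P3 s)%N.
Proof.
elim: s => // x s IH d s1 s2 /=.
have {}IH : (count P1 s + count P2 s <= count P3 s)%N.
  by apply: IH => y ys; [apply: d|apply: s1|apply: s2]; rewrite inE ys orbT.
move: (d x (mem_head _ _)) (s1 x (mem_head _ _)) (s2 x (mem_head _ _)) IH.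
by case: (P1 x); case: (P2 x); case: (P3 x) => //=; lia.
Qed.

Section separated_rays.
Local Open Scope nat_scope.
Variable t : plane_tree.

(** Each of the [y - x.+1] survivors of height [h] strictly between the positions [x] and [y]
    contributes at least [n / J] descendants; multiplying by [J] avoids the division. *)
Lemma count_between J h n x y :
  let s := [seq v <- level t h | surviving t v] in
  y <= size s -> {in s, forall v, n <= J * nsurv n (subtree t v)} ->
  (y - x.+1) * n <= J * count (fun u => surviving t u && (x < index (take h u) s < y))
    (level t (h + n)).
Proof.
move=> s ys growth.
rewrite (count_surviving_add t h n (fun v => x < index v s < y)).
have -> : \sum_(v <- level t h | x < index v s < y) nsurv n (subtree t v) =
    \sum_(v <- s | x < index v s < y) nsurv n (subtree t v).
  rewrite big_filter_cond; apply: eq_bigl => v.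
  (* A vertex outside [s] has index [size s], hence at least [y], and is already excluded by the
     condition on the index. *)
  case: (boolP (surviving t v)) => //= sv; apply/negP => /andP[_].
  by rewrite memNindex ?ltnNge ?ys// mem_filter (negbTE sv).
rewrite big_distrr /= (big_nth [::]) -sum_nat_const_nat.
have su : uniq s by rewrite filter_uniq// level_uniq.
rewrite (big_nat_widen _ _ (size s))// (big_nat_widenl _ 0)//=.
rewrite big_seq_cond [leqRHS]big_seq_cond.
under eq_bigl => i.
  have -> : ((i \in index_iota 0 (size s)) && ((i < y) && (x < i))) =
    ((i \in index_iota 0 (size s)) && (x < index (nth [::] s i) s < y)).
    rewrite mem_index_iota /=; case: ltnP => //= si.
    by rewrite index_uniq// andbC.
  over.
apply: leq_sum => i; rewrite mem_index_iota => /andP[/= si _].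
by apply: growth; rewrite mem_nth.
Qed.


Lemma level_index_between h n (u v : seq nat) :
  let s := [seq v <- level t h | surviving t v] in
  u \in level t (h + n) -> v \in level t (h + n) ->
  surviving t u -> surviving t v ->
  index (take h u) s < index (take h v) s ->
  index u (level t (h + n)) < index v (level t (h + n)).
Proof.
move=> s uh vh su sv.
have take_surviving w : w \in level t (h + n) -> surviving t w ->
    surviving t (take h w).
  move=> /level_split[_ dw] /asboolP sw; apply/asboolP/(survives_up dw).
  by rewrite subtree_cat cat_take_drop.
rewrite index_filter_lt; [exact: level_index_take|exact: take_surviving..].
Qed.

(** At least [4 * J] survivors of height [h] lie strictly between the rays, and as many lie after
    the second one. Each has at least [n / J] surviving descendants at height [h + n], which gives
    [4 * n] on both sides of the cycle. *)
Lemma separation_lt ga gb J h n i j :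
  let s := [seq v <- level t h | surviving t v] in
  ray t ga -> ray t gb -> {in s, forall v, n <= J * nsurv n (subtree t v)} ->
  index (ga h) s = i -> index (gb h) s = j -> i + 4 * J < j ->
  j + 4 * J < size s -> 0 < J -> 4 * n <= separation t ga gb (h + n).
Proof.
move=> s ra rb growth ai bj ij js J0.
set k := h + n; have hk : h <= k by rewrite leq_addr.
have [gak sa _] := ra k; have [gbk sb _] := rb k.
have tk (u : seq nat) : u \in level t k -> take k u = u.
  by move=> /level_size su; rewrite take_oversize ?su.
pose between x y := fun u => surviving t u && (x < index (take h u) s < y).
have ab : rank t k (ga k) + count (between i j) (level t k) <= rank t k (gb k).
  rewrite /rank !tk//; apply: count_disjoint_le => u uk.
  - move=> /andP[_ ua] /andP[su /andP[iu _]].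
    have : index (ga k) (level t k) < index u (level t k).
      by apply: level_index_between => //; rewrite (ray_take ra)// ai.
    by rewrite ltnNge ua.
  - move=> /andP[-> /leq_trans]; apply; apply/ltnW/level_index_between => //.
    by rewrite (ray_take ra)// (ray_take rb)// ai bj; lia.
  - move=> /andP[su /andP[_ uj]]; rewrite su /=.
    by apply/ltnW/level_index_between => //; rewrite (ray_take rb)// bj.
have bN : rank t k (gb k) + count (between j (size s)) (level t k) <= nsurv k t.
  rewrite /rank !tk//; apply: count_disjoint_le => u uk; try by case/andP.
  move=> /andP[_ ub] /andP[su /andP[ju _]].
  have : index (gb k) (level t k) < index u (level t k).
    by apply: level_index_between => //; rewrite (ray_take rb)// bj.
  by rewrite ltnNge ub.
have c1 := @count_between J h n i j (ltnW (leq_ltn_trans (leq_addr _ _) js)) growth.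
have c2 := @count_between J h n j (size s) (leqnn _) growth.
have d1 : 4 * n <= count (between i j) (level t k).
  rewrite -(leq_pmul2l J0); apply: leq_trans c1.
  by rewrite mulnCA mulnA leq_mul2r; apply/orP; right; lia.
have d2 : 4 * n <= count (between j (size s)) (level t k).
  rewrite -(leq_pmul2l J0); apply: leq_trans c2.
  by rewrite mulnCA mulnA leq_mul2r; apply/orP; right; lia.
by rewrite /separation /rank_dist /gap; move: ab bN d1 d2; lia.
Qed.

Lemma separationC ga gb k : separation t ga gb k = separation t gb ga k.
Proof. by rewrite /separation /rank_dist gapC. Qed.

(** The rate [1 / J] is common to all surviving vertices, while the threshold [m] depends on [v].
    Starting from many survivors therefore multiplies the rate. *)
Definition linear_growth J := forall v, surviving t v ->
  exists m, forall n, m <= n -> n <= J * nsurv n (subtree t v).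

Lemma separated_rays J : 0 < J -> survives t -> linear_growth J ->
  exists (g : nat -> nat -> seq nat) (K : nat),
    (forall a, a < 4 -> ray t (g a)) /\
    forall a b k, a < 4 -> b < 4 -> a <> b -> K <= k ->
      k.*2 < separation t (g a) (g b) k.
Proof.
move=> J0 st growth.
(* The four rays are placed at multiples of [M], with [4 * J] survivors strictly between
   neighbouring positions. *)
pose M := (4 * J).+1.
have [m /(_ (m + 4 * M * J)) growth0] : exists m, forall n, m <= n ->
    n <= J * nsurv n t.
  by have [|m Hm] := growth [::]; [exact/asboolP|exists m].
(* Growth at this height gives [4 * M * J <= J * nsurv h t], hence room for four blocks of length
   [M]. *)
set h := m + 4 * M * J in growth0.
pose s := [seq v <- level t h | surviving t v].
have ss : 4 * M <= size s.
  rewrite size_filter -/(nsurv h t) -(leq_pmul2l J0).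
  by apply: leq_trans (growth0 _); rewrite /h; lia.
have [K HK] : exists K, {in s, forall v n, K <= n -> n <= J * nsurv n (subtree t v)}.
  have : {in s, forall v, surviving t v} by move=> v; rewrite mem_filter => /andP[].
  elim: (s) => [|v r IH] sr; first by exists 0.
  have [|K1 H1] := IH; first by move=> w wr; apply: sr; rewrite inE wr orbT.
  have [K2 H2] := growth v (sr _ (mem_head _ _)).
  exists (maxn K1 K2) => w; rewrite inE => /predU1P[->|wr] n; rewrite geq_max => /andP[n1 n2].
    exact: H2.
  exact: H1.
have /choice[g Hg] : forall a, exists g, a < 4 -> ray t g /\ index (g h) s = a * M.
  move=> a; case: (ltnP a 4) => a4; last by exists (fun=> [::]).
  have aM : a * M < size s by apply: leq_trans ss; rewrite ltn_pmul2r.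
  have := mem_nth [::] aM; rewrite mem_filter => /andP[sv vh].
  have [g rg gh] := ray_through vh sv; exists g => _; split => //.
  by rewrite gh index_uniq// filter_uniq// level_uniq.
(* With [n = k - h], this threshold gives [K <= n], so that growth applies, and [h < n], so that
   [4 * n] exceeds [2 * k]. *)
exists g, (h + (K + h).+1); split=> [a /Hg[]//|a b k].
wlog ab : a b / a < b => [W|] a4 b4 ne Kk.
  case: (ltngtP a b) => // ab; first exact: W.
  by rewrite separationC; apply: W => //; exact/nesym.
have [ra ia] := Hg _ a4; have [rb ib] := Hg _ b4.
have hk : h <= k by apply: leq_trans Kk; exact: leq_addr.
have := @separation_lt (g a) (g b) J h (k - h) _ _ ra rb _ ia ib _ _ J0.
rewrite subnKC//; move=> H; apply: leq_trans (H _ _ _).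
- by move: Kk; lia.
- by move=> v vs; apply: HK => //; move: Kk; lia.
- by rewrite -addnS -/M; have : a.+1 * M <= b * M; [rewrite leq_mul2r ab orbT|lia].
- by apply: leq_trans ss; rewrite -addnS -/M; have : b.+1 * M <= 4 * M; [rewrite leq_mul2r b4 orbT|lia].
Qed.

End separated_rays.

(** * Bi-infinite geodesics *)

Section ray_vertices.
Variables (R : realType) (t : plane_tree).
Local Notation M := (causal_map R t).

Lemma ray_in_tree g : ray t g -> forall n, in_tree t (g n).
Proof. by move=> rg n; have [gn _ _] := rg n; rewrite /in_tree (level_size gn). Qed.

Definition ray_vertex g (rg : ray t g) n : vertex M :=
  exist (in_tree t) (g n) (ray_in_tree rg n).

Lemma ray_nonroot g : ray t g -> forall n, in_tree t (g n.+1) && (g n.+1 != [::]).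
Proof.
move=> rg n; rewrite (ray_in_tree rg)/= -size_eq0.
by rewrite (ray_size _ rg).
Qed.

Definition ray_edge g (rg : ray t g) n : edge M :=
  tree_edge (exist (fun u => in_tree t u && (u != [::])) (g n.+1) (ray_nonroot rg n)).

Lemma ray_edge_src g (rg : ray t g) n : edge_src (ray_edge rg n) = ray_vertex rg n.
Proof. by apply/val_inj => /=; have [_ _ ->] := rg n. Qed.

Lemma ray_edge_tgt g (rg : ray t g) n :
  edge_tgt (ray_edge rg n) = ray_vertex rg n.+1.
Proof. exact/val_inj. Qed.

Lemma linked_ray g (rg : ray t g) n :
  linked 1 (ray_vertex rg n) (ray_vertex rg n.+1).
Proof.
exists [:: (ray_edge rg n, true)] => //; rewrite /is_path /dart_src /dart_tgt.
by rewrite ray_edge_src ray_edge_tgt.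
Qed.

Lemma linked_root (x : vertex M) : linked (height x) (Defs.root M) x.
Proof.
move En: (height x) => n; elim: n x En => [|n IH] x xn.
  have -> : x = Defs.root M by apply/val_inj; apply: size0nil xn.
  exact: linked0.
have xn0 : in_tree t (val x) && (val x != [::]).
  by rewrite (valP x) -size_eq0 -/(height x) xn.
pose v := exist (fun u => in_tree t u && (u != [::])) (val x) xn0.
rewrite -addn1; apply: linked_trans (IH (@causal_src t (tree_edge v)) _) _.
  have e : (size (parent (val v))).+1 = height x := size_parent v.
  by apply: succn_inj; rewrite -xn -e.
exists [:: (tree_edge v : edge M, true)] => //=; split=> //; exact/val_inj.
Qed.

Lemma linked_rays g g' (rg : ray t g) (rg' : ray t g') i j :
  linked (i + j) (ray_vertex rg i) (ray_vertex rg' j).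
Proof.
apply: (linked_trans (y := Defs.root M)).
  by apply: linked_sym; rewrite -[X in linked X](ray_size i rg); exact: linked_root.
by rewrite -[X in linked X](ray_size j rg'); exact: linked_root.
Qed.

End ray_vertices.

Section gluing.
Context {R : realType} {M : plane_map R}.

Fixpoint path_nth (x : vertex M) (p : seq dart) n :=
  if n is n'.+1 then if p is a :: p' then path_nth (dart_tgt a) p' n' else x else x.

Lemma path_nth_last x p y n : is_path x p y -> (size p <= n)%N -> path_nth x p n = y.
Proof.
by elim: p x n => [x [|n] //|a p IH x [//|n] /= [_ /IH]]; exact.
Qed.

Lemma linked_path_nth x p y n : is_path x p y ->
  linked 1 (path_nth x p n) (path_nth x p n.+1).
Proof.
elim: p x n => [x [|n] _ /=|a p IH x [|n] /= [ax py]].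
- by apply: linked_le (linked0 _).
- by apply: linked_le (linked0 _).
- by exists [:: a] => //=; case: (p).
- exact: IH.
Qed.

(* The defect [i + j - d(a i, b j)] is nondecreasing in [i] and [j]; if it is
   bounded, the two rays started at a maximising pair and joined by a geodesic
   form a bi-infinite geodesic. *)
Lemma bi_infinite_geodesic_of_rays (a b : nat -> vertex M) K :
  (forall i, linked 1 (a i) (a i.+1)) -> (forall i, linked 1 (b i) (b i.+1)) ->
  (forall i j, linked (i + j) (a i) (b j)) ->
  (forall i j m, linked m (a i) (b j) -> i + j <= m + K)%N ->
  exists g : int -> vertex M, bi_infinite_geodesic g.
Proof.
move=> sa sb ab lower.
pose P n := `[< exists i j m, linked m (a i) (b j) /\ (i + j = m + n)%N >].
have P0 : exists n, P n.
  by exists 0%N; apply/asboolP; exists 0%N, 0%N, 0%N; split=> //; exact: (ab 0%N 0%N).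
have PK n : P n -> (n <= K)%N.
  by move=> /asboolP[i [j [m [/lower lij e]]]]; move: lij e; lia.
case: (ex_maxnP P0 PK) => n0 /asboolP[i0 [j0 [m0 [[p pp ps] e0]]]] nmax.
have defect i j m : linked m (a i) (b j) -> (i + j <= m + n0)%N.
  move=> lm; case: (ltnP (i + j) m) => ij; first lia.
  suff : (i + j - m <= n0)%N by lia.
  by apply: nmax; apply/asboolP; exists i, j, m; split=> //; lia.
have pm : size p = m0.
  have : linked (size p) (a i0) (b j0) by exists p.
  by move=> /defect; lia.
(* Negative integers run along the first ray from [a i0] outwards, [0] to [m0] follow the joining
   geodesic, and the rest runs along the second ray from [b j0]. *)
pose g (z : int) := match z with
  | Posz n => if (n <= m0)%N then path_nth (a i0) p n else b (j0 + (n - m0))%N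
  | Negz n => a (i0 + n.+1)%N end.
have gb n : (m0 <= n)%N -> g n = b (j0 + (n - m0))%N.
  move=> mn /=; case: leqP => // nm.
  by rewrite (path_nth_last pp) ?pm// (eqP (_ : n - m0 == 0)%N) ?addn0// subn_eq0.
exists g; apply: bi_infinite_geodesicP.
  case=> [n|[|n]].
  - rewrite -PoszD addn1; case: (ltnP n m0) => nm.
      by rewrite /= nm (ltnW nm); exact: linked_path_nth pp.
    by rewrite !gb ?(leqW nm)// subSn// addnS.
  - have -> : Negz 0 + 1 = Posz 0 by [].
    rewrite /= addn1.
    by case: (p) pp => [|? ?] _ /=; apply/linked_sym/sa.
  - have -> : Negz n.+1 + 1 = Negz n by lia.
    by rewrite /= [(i0 + n.+2)%N]addnS; exact/linked_sym/sa.
(* The endpoints are [a (i0 + n.+1)] and [b (j0 + (m0 + n - m0))]; since their defect is at most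
   [n0 = i0 + j0 - m0], their distance is at least [m0 + n + n.+1]. *)
move=> n; exists (Negz n), (Posz (m0 + n)); split; [lia|lia|move=> m].
rewrite gb ?leq_addr// addKn /= => /defect.
by lia.
Qed.

End gluing.

Section two_rays.
Variables (R : realType) (t : plane_tree) (K : nat).
Local Notation M := (causal_map R t).
Variables (ga gb : nat -> seq nat).
Hypotheses (ra : ray t ga) (rb : ray t gb).
Hypothesis sep : forall k, (K <= k -> k.*2 < separation t ga gb k)%N.

Lemma causal_bi_infinite_geodesic :
  exists g : int -> vertex M, bi_infinite_geodesic g.
Proof.
apply: (@bi_infinite_geodesic_of_rays _ _ (ray_vertex R ra) (ray_vertex R rb) K.*2).
- exact: linked_ray.
- exact: linked_ray.
- exact: linked_rays.
move=> i j m [p pij pm].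
have [z _] := rays_path_bound ra rb pij erefl erefl.
(* A lowest vertex of height at least [K] makes the path longer than [i + j]; a lower one saves at
   most twice its height. *)
case: (leqP K (height z)) => [/sep|]; lia.
Qed.

End two_rays.

(** * Weak anchored hyperbolicity *)

(** The norm of [R * R] is the maximum norm, so the radius is not the norm itself; the crude factor
    [2] suffices to see that rays are unbounded. *)
Lemma polar_norm (R : realType) (r a : R) : 0 <= r -> r <= 2 * `|polar r a|.
Proof.
move=> r0; have N0 : 0 <= `|polar r a| by [].
have : `|r * cos a| <= `|polar r a| /\ `|r * sin a| <= `|polar r a|.
  by rewrite /polar prod_normE /= !le_max !lexx orbT.
move: N0; move: `|polar r a| => N N0 [hc hs].
have {}hc : (r * cos a) ^+ 2 <= N ^+ 2 by rewrite -real_normK ?num_real// lerXn2r.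
have {}hs : (r * sin a) ^+ 2 <= N ^+ 2 by rewrite -real_normK ?num_real// lerXn2r.
have e : (r * cos a) ^+ 2 + (r * sin a) ^+ 2 = r ^+ 2.
  by rewrite !exprMn -mulrDr cos2Dsin2 mulr1.
by rewrite -(@ler_pXn2r _ 2)// ?nnegrE ?mulr_ge0// exprMn; nra.
Qed.

Section supports.
Context {R : realType} {M : plane_map R}.

Lemma edge_support_connected (e : edge M) : connected (edge_curve e @` `[0, 1]).
Proof.
apply: connected_continuous_connected; first exact: segment_connected.
exact/continuous_subspaceT/edge_curve_cts.
Qed.

Lemma path_support_cases (x y : vertex M) p q : is_path x p y -> path_support x p q ->
  (exists2 v, path_vertices x p v & q = vertex_pos v) \/
  (exists e s, [/\ 0 < s < 1, q = edge_curve e s & path_vertices x p (edge_tgt e)]).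
Proof.
elim: p x => [x /= _ ->|[e b] p IH x]; first by left; exists x.
rewrite [is_path _ _ _]/= => -[ex py].
have vt : path_vertices (dart_tgt (e, b)) p (dart_tgt (e, b)).
  exact: path_vertices_start.
rewrite [path_support _ _]/= => -[[s /=]|/(IH _ py)].
  rewrite in_itv /= => /andP[]; rewrite !le_eqVlt => /predU1P[<- _ <-|s0].
    left; exists (edge_src e); last by rewrite edge_curve0.
    by case: b ex vt {py IH}; [left|right].
  move=> /predU1P[-> <-|s1 <-].
    left; exists (edge_tgt e); last by rewrite edge_curve1.
    by case: b ex vt {py IH}; [right|left].
  right; exists e, s; rewrite s0 s1; split=> //.
  by case: b ex vt {py IH}; [right|left].
move=> [[v pv ->]|[e' [s [s01 -> pe']]]]; first by left; exists v => //; right.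
by right; exists e', s; split=> //; right.
Qed.

End supports.

Section ray_hit.
Variables (R : realType) (t : plane_tree) (g : nat -> seq nat) (rg : ray t g).
Local Notation M := (causal_map R t).
Local Notation v := (ray_vertex R rg).
Local Notation e := (ray_edge R rg).

Let ray_support := \bigcup_n (edge_curve (e n) @` `[0, 1]).

Lemma ray_support_vertex n : ray_support (vertex_pos (v n)).
Proof.
exists n => //; exists 0; first by rewrite /= in_itv /= lexx ler01.
by rewrite edge_curve0 ray_edge_src.
Qed.

Lemma ray_support_connected : connected ray_support.
Proof.
pose I i := edge_curve (e i) @` `[0, 1].
pose S n := \big[setU/set0]_(i < n.+1) I i.
have SE : ray_support = \bigcup_n S n.
  apply/seteqP; split=> [x [n _ xn]|x [n _]].
    by exists n => //; rewrite /S big_ord_recr /=; right.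
  rewrite /S -(bigcup_mkord n.+1 I) => -[i _ xi]; by exists i.
have Sn n : S n (vertex_pos (v n.+1)).
  rewrite /S big_ord_recr; right; exists 1; first by rewrite /= in_itv /= lexx ler01.
  by rewrite edge_curve1 ray_edge_tgt.
rewrite SE; apply: bigcup_connected => [|n _].
  exists (vertex_pos (v 1)) => n _; rewrite /S -(bigcup_mkord n.+1 I).
  exists 0%N => //; exists 1; first by rewrite /= in_itv /= lexx ler01.
  by rewrite edge_curve1 ray_edge_tgt.
elim: n => [|n IH]; first by rewrite /S big_ord1; exact: edge_support_connected.
rewrite /S big_ord_recr; apply: (connectedU _ IH (@edge_support_connected _ M (e n.+1))).
exists (vertex_pos (v n.+1)); split=> //; exists 0; first by rewrite /= in_itv /= lexx ler01.
by rewrite edge_curve0 ray_edge_src.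
Qed.

Lemma ray_support_unbounded : ~ bounded_set ray_support.
Proof.
move=> [B [_ /(_ (`|B| + 1))]] H.
have {}H := H (ltr_pwDr ltr01 (ler_norm B)).
pose n := (Num.truncn (2 * (`|B| + 1))).+1.
have lt_n : 2 * (`|B| + 1) < n%:R by rewrite truncnS_gt.
have := H _ (ray_support_vertex n).
have := @polar_norm R n%:R (angle R t (g n)) (ler0n _ _).
have -> : polar n%:R (angle R t (g n)) = vertex_pos (v n).
  by rewrite /= /causal_pos /= (ray_size _ rg).
by move=> /= h1 h2; lra.
Qed.

(** A ray avoiding [K] would be a connected unbounded set containing the root, and would lie inside
    the bounded component of the root. *)
Lemma surrounds_hits_ray K : surrounds K (vertex_pos (Defs.root M)) ->
  exists n s, 0 <= s <= 1 /\ K (edge_curve (e n) s).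
Proof.
move=> bK; apply: contrapT => H; apply: ray_support_unbounded.
have sub : ray_support `<=` connected_component (~` K) (vertex_pos (Defs.root M)).
  apply: connected_component_max; last exact: ray_support_connected.
    have -> : Defs.root M = v 0%N.
      by apply/val_inj => /=; apply/esym/size0nil/(ray_size _ rg).
    exact: ray_support_vertex.
  move=> _ [n _ [s /= s01 <-]] Kq; apply: H; exists n, s.
  by rewrite in_itv in s01.
case: bK => B [Br H']; exists B; split=> // x Bx y /sub; exact: H'.
Qed.

(** By the embedding, a path and a ray can meet only at a common vertex or inside a common edge, and
    either puts a vertex of the ray on the path. *)
Lemma path_hits_ray x y p n s : is_path x p y -> 0 <= s <= 1 ->
  path_support x p (edge_curve (e n) s) -> exists i, path_vertices x p (v i).
Proof.
move=> px /andP[s0 s1] /(path_support_cases px) cases.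
have vertex_case i : edge_curve (e n) s = vertex_pos (v i) ->
    exists i, path_vertices x p (v i).
  move=> E; exists i; case: cases; rewrite E => -[].
    by move=> w pw /vertex_pos_inj ->.
  by move=> e' [s' [s01 /esym/edge_curve_vertex]] => /(_ s01).
move: s0; rewrite le_eqVlt => /predU1P[s0|s0].
  by apply: (vertex_case n); rewrite -s0 edge_curve0 ray_edge_src.
move: s1; rewrite le_eqVlt => /predU1P[s1|s1].
  by apply: (vertex_case n.+1); rewrite s1 edge_curve1 ray_edge_tgt.
have s01 : 0 < s < 1 by rewrite s0 s1.
case: cases => [[w _ /edge_curve_vertex]|[e' [s' [s01' /edge_curve_inj]]]].
  by move=> /(_ s01).
by move=> /(_ s01 s01')[<- _]; rewrite ray_edge_tgt => pv; exists n.+1.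
Qed.

End ray_hit.

Section weak_hyperbolicity.
Variables (R : realType) (t : plane_tree) (K : nat).
Local Notation M := (causal_map R t).

(** The piece between the two rays is geodesic, so it is no longer than the detour through the root,
    [i + j]. By [rays_path_bound] it cannot stay above height [K]. *)
Lemma geodesic_through_rays ga gb (ra : ray t ga) (rb : ray t gb) (x y : vertex M) p i j :
  (forall k, K <= k -> k.*2 < separation t ga gb k)%N ->
  geodesic x p y -> path_vertices x p (ray_vertex R ra i) ->
  path_vertices x p (ray_vertex R rb j) ->
  exists2 z, path_vertices x p z & (height z <= K)%N.
Proof.
(* The geodesic may meet the two rays in either order; the separation is symmetric. *)
wlog : ga gb ra rb i j / exists p1 p2 p3, [/\ p = p1 ++ p2 ++ p3,
    is_path x p1 (ray_vertex R ra i),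
    is_path (ray_vertex R ra i) p2 (ray_vertex R rb j) &
    is_path (ray_vertex R rb j) p3 y].
  move=> W sep gp pa pb.
  have [p1 [p2 [pE p1a p2a]]] := path_vertices_split gp.1 pa.
  have /(path_vertices_cat p2 _ p1a)[pb1|pb2] : path_vertices x (p1 ++ p2) (ray_vertex R rb j).
    by rewrite -pE.
    have [p11 [p12 [pE1 p11b p12b]]] := path_vertices_split p1a pb1.
    apply: (W gb ga rb ra j i) => //.
      by exists p11, p12, p2; rewrite pE pE1 -catA.
    by move=> k; rewrite separationC; exact: sep.
  have [p21 [p22 [pE2 p21b p22b]]] := path_vertices_split p2a pb2.
  by apply: (W ga gb ra rb i j) => //; exists p1, p21, p22; rewrite pE pE2.
move=> [p1 [p2 [p3 [pE p1a p2ab p3b]]]] sep gp _ _.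
have sp2 : (size p2 <= i + j)%N.
  rewrite pE in gp; apply: geodesic_mid gp p1a p2ab p3b _; exact: linked_rays.
have [z zp2 zK] := rays_path_bound ra rb p2ab erefl erefl.
exists z.
  rewrite pE; apply/(path_vertices_cat _ _ p1a); right.
  by apply/(path_vertices_cat _ _ p2ab); left.
by rewrite leqNgt; apply/negP => /ltnW/sep; lia.
Qed.

Lemma causal_weakly_anchored_hyperbolic (g : nat -> nat -> seq nat) :
  (forall a, a < 4 -> ray t (g a))%N ->
  (forall a b k, a < 4 -> b < 4 -> a <> b -> K <= k ->
      k.*2 < separation t (g a) (g b) k)%N ->
  weakly_anchored_hyperbolic M.
Proof.
move=> rg sep; exists K%:R => // x y z pxy pyz pzx gxy gyz gzx surr.
pose side (c : 'I_3) : set (vertex M) :=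
  nth set0 [:: path_vertices x pxy; path_vertices y pyz; path_vertices z pzx] c.
have /choice[f Hf] : forall a : 'I_4, exists c, exists i,
    side c (ray_vertex R (rg a (ltn_ord a)) i).
  move=> a; have [n [s [s01 [[]|]]]] := surrounds_hits_ray (rg a (ltn_ord a)) surr.
  - by move=> /(path_hits_ray gxy.1 s01)[i Hi]; exists ord0, i.
  - by move=> /(path_hits_ray gyz.1 s01)[i Hi]; exists (inord 1), i; rewrite /side inordK.
  - by move=> /(path_hits_ray gzx.1 s01)[i Hi]; exists (inord 2), i; rewrite /side inordK.
(* Pigeonhole: four rays are met by three sides. *)
have /injectivePn[a [b ab fab]] : ~~ injectiveb f.
  by apply/negP => /injectiveP/leq_card; rewrite !card_ord.
have [i Hi] := Hf a; have [j Hj] := Hf b; rewrite -fab in Hj.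
have sep' k : (K <= k -> k.*2 < separation t (g a) (g b) k)%N.
  by apply: sep => // /val_inj E; rewrite E eqxx in ab.
have [w sw wK] : exists2 w, (path_vertices x pxy `|` path_vertices y pyz
                   `|` path_vertices z pzx) w & (height w <= K)%N.
  case: (f a) Hi Hj {fab} => -[|[|[|//]]] ? /= Hi Hj.
  - by have [w ? ?] := geodesic_through_rays sep' gxy Hi Hj; exists w => //; left; left.
  - by have [w ? ?] := geodesic_through_rays sep' gyz Hi Hj; exists w => //; left; right.
  - by have [w ? ?] := geodesic_through_rays sep' gzx Hi Hj; exists w => //; right.
apply: ge_ereal_inf; exists (graph_dist (Defs.root M) w); first by exists w.
exact/graph_dist_le/(linked_le wK)/linked_root.
Qed.

End weak_hyperbolicity.

(** * The law of a Galton-Watson tree *)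

Section tree_space.
Implicit Types (J : seq (seq nat)) (B : seq nat -> set nat).

Definition cylinder J B : set plane_tree := [set t | forall u, u \in J -> B u (t u)].

(** A pi-system generating the product sigma-algebra on trees. Lists without repetition are used
    because independence gives one factor per entry of [J]. *)
Definition cylinders : set (set plane_tree) :=
  [set C | exists J B, uniq J /\ C = cylinder J B].

Lemma setI_closed_cylinders : setI_closed cylinders.
Proof.
move=> _ _ [J [B [_ ->]]] [J' [B' [_ ->]]].
exists (undup (J ++ J')), (fun u => [set n | (u \in J -> B u n) /\ (u \in J' -> B' u n)]).
split; first exact: undup_uniq.
apply/seteqP; split=> [t [tJ tJ'] u _|t H]; first by split=> [/tJ|/tJ'].
have uH u : (u \in J) || (u \in J') -> (u \in J -> B u (t u)) /\ (u \in J' -> B' u (t u)).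
  by move=> uJ; apply: H; rewrite mem_undup mem_cat.
by split=> u uJ; [apply: (uH u _).1|apply: (uH u _).2]; rewrite ?uJ ?orbT.
Qed.

End tree_space.

Notation tree_space := (g_sigma_algebraType cylinders).

Lemma measurable_cylinder J B : measurable (cylinder J B : set tree_space).
Proof.
apply: sub_sigma_algebra; exists (undup J), B; split; first exact: undup_uniq.
by apply/seteqP; split=> t H u; have := H u; rewrite mem_undup.
Qed.

Lemma measurable_offspring u (B : set nat) :
  measurable ([set t | B (t u)] : set tree_space).
Proof.
rewrite (_ : [set t | B (t u)] = cylinder [:: u] (fun=> B)); first exact: measurable_cylinder.
by apply/seteqP; split=> t /=; [move=> Bt v; rewrite inE => /eqP ->|apply; exact: mem_head].
Qed.

Definition subtree_at v (t : tree_space) : tree_space := subtree t v.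

Lemma measurable_subtree_at v : measurable_fun setT (subtree_at v).
Proof.
apply: (@measurability _ _ _ tree_space _ _ cylinders) => // _ [_ [J [B [_ ->]]] <-]; rewrite setTI.
rewrite (_ : _ @^-1` _ = cylinder (map (cat v) J) (fun u => B (drop (size v) u))).
  exact: measurable_cylinder.
apply/seteqP; split=> t H u.
  by move=> /mapP[w wJ ->]; rewrite drop_size_cat//; exact: H.
by move=> uJ; have := H (v ++ u); rewrite drop_size_cat//; apply; exact: map_f.
Qed.

HB.instance Definition _ v := @isMeasurableFun.Build _ _ tree_space tree_space
  (subtree_at v) (measurable_subtree_at v).

Section law.
Context d (Omega : measurableType d) (R : realType) (P : probability Omega R).
Variables (X : seq nat -> {RV P >-> nat}) (mu : probability nat R).
Hypothesis GW : galton_watson X mu.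

Definition gw_tree (w : Omega) : tree_space := random_tree X w.

Lemma gw_tree_cylinder J B : gw_tree @^-1` cylinder J B =
  \bigcap_(u in [set` J]) (X u @^-1` B u).
Proof. by apply/seteqP; split=> w H u /H. Qed.

Lemma measurable_gw_tree : measurable_fun setT gw_tree.
Proof.
apply: (@measurability _ _ _ tree_space _ _ cylinders) => // _ [_ [J [B [_ ->]]] <-]; rewrite setTI.
rewrite gw_tree_cylinder bigcap_seq; apply: bigsetI_measurable => u _.
exact: measurable_funPTI.
Qed.

HB.instance Definition _ := @isMeasurableFun.Build _ _ Omega tree_space
  gw_tree measurable_gw_tree.

Definition gw_law : probability tree_space R := distribution P gw_tree.

Lemma gw_law_cylinder J B : uniq J ->
  gw_law (cylinder J B) = (\prod_(u <- J) mu (B u))%E.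
Proof.
move=> uJ; rewrite -[LHS]/(P (gw_tree @^-1` cylinder J B)) gw_tree_cylinder.
rewrite GW.2//; apply: eq_bigr => u _; exact: GW.1.
Qed.

(** For fixed [E], both sides are finite measures in [A] that agree on the pi-system of cylinders,
    hence everywhere. *)
Lemma independent_of_cylinders (E : set Omega) (f : {mfun Omega >-> tree_space}) :
  measurable E ->
  (forall J B, uniq J ->
     P (E `&` f @^-1` cylinder J B) = (P E * gw_law (cylinder J B))%E) ->
  forall A : set tree_space, measurable A -> P (E `&` f @^-1` A) = (P E * gw_law A)%E.
Proof.
move=> mE H A mA.
have PE : P E \is a fin_num by exact: fin_num_measure.
have fPE : 0 <= fine (P E) by rewrite fine_ge0.
have mf : measurable_fun setT f by [].
pose m1_of : {measure set tree_space -> \bar R} := pushforward (mrestr P mE) f.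
pose m1 := m1_of mf.
pose m2 : {measure set tree_space -> \bar R} := mscale (NngNum fPE) gw_law.
have m1E C : m1 C = P (E `&` f @^-1` C) by rewrite /m1 /m1_of /= /pushforward /mrestr setIC.
have m2E C : m2 C = (P E * gw_law C)%E by rewrite /m2 /= /mscale /= fineK.
rewrite -m1E -m2E.
apply: (@g_sigma_algebra_measure_unique _ R tree_space cylinders _ (fun=> setT)
  _ _ m1 m2 _ _ _ A mA) => //.
- by move=> C; exact: sub_sigma_algebra.
- by move=> _; exists [::], (fun=> setT); split => //; apply/seteqP; split.
- by rewrite bigcup_const//; exists 0%N.
- exact: setI_closed_cylinders.
- by move=> _ [J [B [uJ ->]]]; rewrite m1E m2E; exact: H.
- move=> _; rewrite m1E; apply: (@le_lt_trans _ _ 1%E); last by rewrite ltry.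
  by rewrite preimage_setT setIT probability_le1.
Qed.

(* [J] and [B] constrain offspring numbers outside the subtrees of the children
   smaller than [n]; they are what is left of the cylinders at a given stage of
   their replacement, one child after the other, by arbitrary events. *)
Lemma gw_branching_cylinder n (A : nat -> set tree_space) J B :
  (forall j, measurable (A j)) -> uniq J ->
  (forall j u, j :: u \in J -> (n <= j)%N) ->
  P ((\bigcap_(j < n) [set w | A j (subtree (gw_tree w) [:: j])]) `&`
     gw_tree @^-1` cylinder J B) =
  (\prod_(j < n) gw_law (A j) * gw_law (cylinder J B))%E.
Proof.
move=> mA; elim: n J B => [|n IH] J B uJ nJ.
  rewrite big_ord0 mul1e; congr (P _).
  by apply/seteqP; split=> [w []//|w]; split.
pose f : {mfun Omega >-> tree_space} := subtree_at [:: n] \o gw_tree.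
pose E := (\bigcap_(j < n) [set w | A j (subtree (gw_tree w) [:: j])]) `&`
  gw_tree @^-1` cylinder J B.
have mE : measurable E.
  apply: measurableI; last exact: measurable_funPTI (measurable_cylinder _ _).
  rewrite bigcap_mkord; apply: bigsetI_measurable => j _.
  exact: (@measurable_funPTI _ _ _ _ (subtree_at [:: nat_of_ord j] \o gw_tree)).
have PE : P E = (\prod_(j < n) gw_law (A j) * gw_law (cylinder J B))%E.
  by rewrite IH// => j u /nJ/ltnW.
have H J' B' : uniq J' ->
    P (E `&` f @^-1` cylinder J' B') = (P E * gw_law (cylinder J' B'))%E.
  move=> uJ'; rewrite PE -muleA.
  (* A cylinder for the subtree of child [n] constrains the words [n :: v], none of which is in [J],
     so it merges with [cylinder J B] into one cylinder. *)
  pose B'' u := if u is j :: v then if j == n then B' v else B u else B u.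
  have -> : E `&` f @^-1` cylinder J' B' =
      (\bigcap_(j < n) [set w | A j (subtree (gw_tree w) [:: j])]) `&`
      gw_tree @^-1` cylinder (J ++ map (cons n) J') B''.
    rewrite /E -setIA; congr (_ `&` _); apply/seteqP; split=> w.
      move=> [H1 H2] u; rewrite mem_cat => /orP[uJ1|/mapP[v vJ' ->]]; last first.
        by rewrite /B'' eqxx; exact: H2.
      rewrite /B''; case: u uJ1 => [|j u] uJ1; first exact: H1.
      by case: eqVneq => [jn|_]; [have := nJ _ _ uJ1; rewrite jn ltnn|exact: H1].
    move=> H1; split=> [u uJ1|u uJ1].
      have := H1 u; rewrite mem_cat uJ1 => /(_ isT).
      rewrite /B''; case: u uJ1 => [|j u] uJ1 //.
      by case: eqVneq => // jn; have := nJ _ _ uJ1; rewrite jn ltnn.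
    have := H1 (n :: u); rewrite mem_cat map_f// orbT => /(_ isT).
    by rewrite /B'' eqxx.
  have uJJ : uniq (J ++ map (cons n) J').
    rewrite cat_uniq uJ map_inj_uniq ?uJ'; last by move=> ? ? [].
    rewrite andbT; apply/hasPn => _ /mapP[u _ ->]; apply/negP => /nJ.
    by rewrite ltnn.
  rewrite IH//; last first.
    by move=> j u; rewrite mem_cat => /orP[/nJ/ltnW//|/mapP[v _ [-> _]]].
  congr (_ * _)%E; rewrite !gw_law_cylinder// big_cat /= big_map; congr (_ * _)%E.
    apply: eq_big_seq => -[|j u] uJ1 //=.
    by case: eqVneq => // jn; have := nJ _ _ uJ1; rewrite jn ltnn.
  by apply: eq_bigr => u _; rewrite /= eqxx.
have := independent_of_cylinders mE H (mA n).
rewrite PE => HA; rewrite big_ord_recr /= -muleA [X in _ = (_ * X)%E]muleC muleA -HA.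
congr (P _); rewrite /E setIAC; congr (_ `&` _).
apply/seteqP; split=> w.
  by move=> H1; split=> [j jn|]; apply: H1 => //=; exact: ltnW.
by move=> [H1 H2] j /=; rewrite ltnS leq_eqVlt => /predU1P[->//|]; exact: H1.
Qed.

(** The number [n] of subtrees is not tied to the offspring number [t [::]]: [subtree t [:: j]]
    makes sense, and has law [nu], even if child [j] is not in the tree. *)
Definition branching (nu : probability tree_space R) :=
  forall n (A : nat -> set tree_space) (B : set nat), (forall j, measurable (A j)) ->
    nu [set t | B (t [::]) /\ forall j, (j < n)%N -> A j (subtree t [:: j])] =
    (mu B * \prod_(j < n) nu (A j))%E.

Lemma gw_law_branching : branching gw_law.
Proof.
move=> n A B mA.
have := @gw_branching_cylinder n A [:: [::]] (fun=> B) mA isT.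
rewrite gw_law_cylinder// big_seq1 muleC => <-; last by [].
rewrite -[LHS]/(P (gw_tree @^-1` _)); congr (P _).
apply/seteqP; split=> w.
  by move=> [Bw H]; split=> [j jn|u]; [exact: H|rewrite inE => /eqP ->].
by move=> [H Bw]; split=> [|j]; [apply: Bw; rewrite inE|exact: H].
Qed.

End law.

(** * Measurability of extinction, survival and the number of survivors *)

Section measurable_events.

Lemma measurable_subtree_preimage v (A : set tree_space) : measurable A ->
  measurable ([set t | A (subtree t v)] : set tree_space).
Proof. by move=> mA; have := measurable_funPTI (subtree_at v) mA. Qed.

Lemma measurable_branch n (A : nat -> set tree_space) (B : set nat) :
  (forall j, measurable (A j)) ->
  measurable ([set t | B (t [::]) /\ forall j, (j < n)%N -> A j (subtree t [:: j])]
    : set tree_space).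
Proof.
move=> mA; apply: (@measurableI _ tree_space [set t | B (t [::])]
  (\bigcap_(j < n) [set t | A j (subtree t [:: j])])).
  exact: measurable_offspring.
by apply: bigcap_measurableType => j _; exact: measurable_subtree_preimage.
Qed.

Definition extinct_by n : set tree_space := [set t | level t n = [::]].

Lemma extinct_byS n t : extinct_by n.+1 t <->
  forall j, (j < t [::])%N -> extinct_by n (subtree t [:: j]).
Proof.
rewrite /extinct_by -add1n /mkset level_add level_1; split=> H.
  move=> j jt; apply/eqP; apply: contraT => /mem_neq_nil[w wn].
  have : ([:: j] ++ w) \in flatten [seq [seq v ++ w0 | w0 <- level (subtree t v) n]
      | v <- [seq [:: i] | i <- iota 0 (t [::])]].
    apply/flatten_mapP; exists [:: j]; last exact: map_f.
    by rewrite map_f// mem_iota.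
  by rewrite H.
apply/eqP; apply: contraT => /mem_neq_nil[w /flatten_mapP[v /mapP[j jt ->]]].
by move: jt; rewrite mem_iota => /H ->.
Qed.

Lemma measurable_extinct_by n : measurable (extinct_by n).
Proof.
elim: n => [|n IH].
  rewrite (_ : extinct_by 0 = set0); first exact: measurable0.
  by apply/seteqP; split.
rewrite (_ : extinct_by n.+1 = \bigcup_k [set t | [set k] (t [::]) /\
    forall j, (j < k)%N -> extinct_by n (subtree t [:: j])]).
  apply: bigcupT_measurable => k.
  exact: (@measurable_branch k (fun=> extinct_by n) [set k]).
apply/seteqP; split=> [t /extinct_byS H|t [_ _ [<- H]]].
  by exists (t [::]).
exact/extinct_byS.
Qed.

Definition surviving_trees : set tree_space := [set t | survives t].

Lemma surviving_treesE : surviving_trees = ~` \bigcup_n extinct_by n.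
Proof.
apply/seteqP; split=> [t st [n _ /= e]|t H n]; first by have := st n; rewrite e.
by apply/eqP => e; apply: H; exists n.
Qed.

Lemma measurable_surviving_trees : measurable surviving_trees.
Proof.
rewrite surviving_treesE; apply: measurableC; apply: bigcupT_measurable => n.
exact: measurable_extinct_by.
Qed.

Lemma measurable_nsurv k m : measurable ([set t | nsurv k t = m] : set tree_space).
Proof.
elim: k m => [|k IH] m.
  rewrite (_ : [set t | _] = (surviving_trees `&` [set _ | m = 1%N]) `|`
      (~` surviving_trees `&` [set _ | m = 0%N])).
    have mc (Q : Prop) : measurable ([set _ | Q] : set tree_space).
      by case: (pselect Q) => q; [rewrite (_ : [set _ | _] = setT)|rewrite (_ : [set _ | _] = set0)]
        => //; apply/seteqP; split.
    apply: measurableU; apply: measurableI => //; last apply: measurableC;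
      exact: measurable_surviving_trees.
  apply/seteqP; split=> t /=; rewrite nsurv0 /surviving.
    by case: (asboolP (survives _)) => st <-; [left|right].
  by move=> [[st ->]|[st ->]]; case: (asboolP (survives _)).
(* With a fixed number [n] of summands, induction on [n] splits the event by the value [a] of the
   partial sum. *)
have sum_meas n m' : measurable
    ([set t | (\sum_(i < n) nsurv k (subtree t [:: i : nat]))%N = m'] : set tree_space).
  elim: n m' => [|n IHn] m'.
    case: (eqVneq m' 0%N) => [->|m0].
      by rewrite (_ : [set t | _] = setT)//; apply/seteqP; split=> t //= _; rewrite big_ord0.
    rewrite (_ : [set t | _] = set0)//; apply/seteqP; split=> t //=.
    by rewrite big_ord0 => m0'; rewrite -m0' eqxx in m0.
  rewrite (_ : [set t | _] = \bigcup_a ([set t | (\sum_(i < n) nsurv k (subtree t [:: i : nat]))%N = a]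
     `&` [set t | [set b | (a + b)%N = m'] (nsurv k (subtree t [:: n]))])).
    apply: bigcupT_measurable => a; apply: measurableI => //.
    apply: (@measurable_subtree_preimage [:: n] [set t | [set b | (a + b)%N = m'] (nsurv k t)]).
    rewrite (_ : [set t | _] = \bigcup_(b in [set b | (a + b)%N = m']) [set t | nsurv k t = b]).
      by apply: bigcup_measurable => b _; exact: IH.
    by apply/seteqP; split=> [t /= e|t [b /= e ->]//]; exists (nsurv k t).
  apply/seteqP; split=> t /=; rewrite big_ord_recr /=; first by eexists.
  by move=> [a _ [-> ]].
rewrite (_ : [set t | _] = \bigcup_n ([set t | [set n] (t [::])] `&`
    [set t | (\sum_(i < n) nsurv k (subtree t [:: i : nat]))%N = m])).
  apply: bigcupT_measurable => n; apply: measurableI => //; exact: measurable_offspring.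
by apply/seteqP; split=> t /=; rewrite nsurvS; [exists (t [::])|move=> [n _ [/= ->]]].
Qed.

End measurable_events.

(** * Survival *)

Lemma bernoulli_le (R : realFieldType) (x : R) n : 0 <= x <= 1 ->
  1 - n%:R * x <= (1 - x) ^+ n.
Proof.
move=> /andP[x0 x1]; elim: n => [|n IH]; first by rewrite mul0r subr0 expr0.
rewrite exprS -natr1; have n0 : 0 <= n%:R :> R by [].
apply: (@le_trans _ _ ((1 - x) * (1 - n%:R * x))); first by nra.
by apply: ler_wpM2l => //; lra.
Qed.

(* With [s = 1 - x], each [1 - s ^+ i] is at least [i x s ^+ N], and
   [s ^+ N >= 1 - N x] by Bernoulli's inequality; [x] is chosen so that
   [(1 - N x) \sum_i i m_i >= 1]. *)
Lemma supercritical_subinvariant (R : realFieldType) N (m : nat -> R) :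
  (forall i, 0 <= m i) -> 1 < \sum_(i < N) i%:R * m i ->
  exists2 s, 0 <= s < 1 & 1 - s <= \sum_(i < N) m i * (1 - s ^+ i).
Proof.
move=> m0 a1; set a := \sum_(i < N) _ in a1.
have a0 : 0 < a by lra.
have N0 : 0 < N.+1%:R :> R by rewrite ltr0n.
have [x x0 xE] : exists2 x, 0 < x & x * N.+1%:R * a = a - 1.
  exists ((a - 1) / (a * N.+1%:R)); first by rewrite divr_gt0 ?mulr_gt0 ?subr_gt0.
  by field; rewrite !gt_eqF.
have x1 : x < 1.
  have : x * a <= a - 1.
    have : 1 <= N.+1%:R :> R by rewrite ler1n.
    have : 0 < x * a by exact: mulr_gt0.
    by move: xE; nra.
  by nra.
have s01 : 0 <= 1 - x < 1 by lra.
exists (1 - x) => //; rewrite opprB addrC subrK.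
have term i : (i <= N)%N -> i%:R * x * (1 - x) ^+ N <= 1 - (1 - x) ^+ i.
  elim: i => [_|i IH iN]; first by rewrite !mul0r expr0 subrr.
  have {}IH := IH (ltnW iN).
  have : (1 - x) ^+ N <= (1 - x) ^+ i by rewrite ler_wiXn2l ?(ltnW iN)//; lra.
  by rewrite -natr1 exprS; nra.
apply: (@le_trans _ _ (\sum_(i < N) m i * (i%:R * x * (1 - x) ^+ N))); last first.
  by apply: ler_sum => i _; rewrite ler_wpM2l// term// ltnW.
have -> : \sum_(i < N) m i * (i%:R * x * (1 - x) ^+ N) = x * ((1 - x) ^+ N * a).
  by rewrite /a !mulr_sumr; apply: eq_bigr => i _; ring.
rewrite ler_peMr ?(ltW x0)//.
have := @bernoulli_le R x N; rewrite (ltW x0) (ltW x1) => /(_ isT) B.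
have : x * N%:R * a <= a - 1 by rewrite -xE -natr1; nra.
by nra.
Qed.

Section supercritical_branching.
Context (R : realType) (mu : probability nat R) (nu : probability tree_space R).
Hypothesis br : branching mu nu.
Hypothesis mean_gt1 : (1 < \sum_(0 <= i <oo) i%:R%:E * mu [set i])%E.

Definition offspring_prob i := fine (mu [set i]).
Local Notation m_ := offspring_prob.
Definition pr (A : set tree_space) := fine (nu A).

Lemma offspring_probE i : mu [set i] = (m_ i)%:E.
Proof. by rewrite fineK// fin_num_measure. Qed.

Lemma offspring_prob_ge0 i : 0 <= m_ i.
Proof. exact: fine_ge0. Qed.

Lemma prE A : measurable A -> nu A = (pr A)%:E.
Proof. by move=> mA; rewrite fineK// fin_num_measure. Qed.

Lemma pr_ge0 A : 0 <= pr A.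
Proof. exact: fine_ge0. Qed.

Lemma pr_le1 A : measurable A -> pr A <= 1.
Proof. by move=> mA; rewrite -lee_fin -prE// probability_le1. Qed.

Lemma pr_branch n (A : nat -> set tree_space) (B : set nat) :
  (forall j, measurable (A j)) ->
  pr [set t | B (t [::]) /\ forall j, (j < n)%N -> A j (subtree t [:: j])] =
  fine (mu B) * \prod_(j < n) pr (A j).
Proof.
move=> mA; rewrite /pr br//.
under eq_bigr do rewrite prE//.
by rewrite prodEFin -[mu B]fineK ?fin_num_measure// -EFinM.
Qed.

(** The mean may be infinite, but some partial sum already exceeds [1], so that finite sums suffice
    from here on. *)
Lemma mean_truncation : exists N, 1 < \sum_(i < N) i%:R * m_ i.
Proof.
apply: contrapT => /forallNP H.
have : (\sum_(0 <= i <oo) i%:R%:E * mu [set i] <= 1)%E.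
  apply: lime_le.
    by apply: is_cvg_nneseries => i _ _; rewrite mule_ge0// lee_fin.
  apply: nearW => N; rewrite big_mkord.
  under eq_bigr do rewrite offspring_probE -EFinM.
  by rewrite sumEFin lee_fin leNgt; exact/negP/H.
by rewrite leNgt mean_gt1.
Qed.

Lemma sum_offspring_prob N : \sum_(i < N) m_ i = fine (mu `I_N).
Proof.
elim: N => [|N IH]; first by rewrite big_ord0 II0 measure0.
rewrite big_ord_recr /= IH IIS measureU//; last first.
  by apply/seteqP; split=> // i [/= iN e]; rewrite e ltnn in iN.
by rewrite fineD ?fin_num_measure.
Qed.

(** The recursion of extinction probabilities through the generating function, truncated at [N]:
    offspring numbers of at least [N] are bounded by their total mass, the event [L]. *)
Lemma pr_extinct_byS N n : pr (extinct_by n.+1) <=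
  1 - \sum_(i < N) m_ i * (1 - pr (extinct_by n) ^+ i).
Proof.
pose E i : set tree_space := [set t | [set i] (t [::]) /\
  forall j, (j < i)%N -> extinct_by n (subtree t [:: j])].
pose L : set tree_space := [set t | (~` `I_N) (t [::]) /\
  forall j, (j < 0)%N -> setT (subtree t [:: j])].
have mE i : measurable (E i).
  by apply: (@measurable_branch i (fun=> extinct_by n)) => _; exact: measurable_extinct_by.
have mL : measurable L by exact: (@measurable_branch 0 (fun=> setT)).
have mU : measurable (\big[setU/set0]_(i < N) E i).
  exact: bigsetU_measurable.
have prEi i : pr (E i) = m_ i * pr (extinct_by n) ^+ i.
  rewrite /E (@pr_branch i (fun=> extinct_by n)); last first.
    by move=> _; exact: measurable_extinct_by.
  by rewrite prodr_const card_ord.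
have prL : pr L = 1 - \sum_(i < N) m_ i.
  rewrite /L (@pr_branch 0 (fun=> setT))// big_ord0 mulr1 sum_offspring_prob.
  by rewrite probability_setC// fineB ?fin_num_measure.
have : (nu (extinct_by n.+1) <= nu (\big[setU/set0]_(i < N) E i) + nu L)%E.
  apply: (le_trans _ (measureU2 _ mU mL)).
  apply: le_measure; rewrite ?inE; [exact: measurable_extinct_by|exact: measurableU|].
  move=> t /extinct_byS H; case: (ltnP (t [::]) N) => tN.
    by left; rewrite -bigcup_mkord; exists (t [::]) => //; split.
  by right; split=> //= lt; move: tN; rewrite leqNgt lt.
move/le_trans => /(_ (\sum_(i < N) nu (E i) + nu L)%E).
rewrite leeD2r ?Boole_inequality// => /(_ isT).
under eq_bigr do rewrite prE//.
rewrite !prE//; last exact: measurable_extinct_by.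
rewrite sumEFin -EFinD lee_fin prL => /le_trans; apply.
under eq_bigr do rewrite prEi.
have -> : \sum_(i < N) m_ i * (1 - pr (extinct_by n) ^+ i) =
    \sum_(i < N) m_ i - \sum_(i < N) m_ i * pr (extinct_by n) ^+ i.
  by rewrite -sumrB; apply: eq_bigr => i _; rewrite mulrBr mulr1.
by lra.
Qed.

(** The recursion preserves the bound [s < 1] given by [supercritical_subinvariant], so the limit of
    the extinction probabilities is at most [s]. *)
Lemma survival_prob_gt0 : 0 < pr surviving_trees.
Proof.
have [N /(supercritical_subinvariant offspring_prob_ge0)[s /andP[s0 s1] sN]] := mean_truncation.
have es n : pr (extinct_by n) <= s.
  elim: n => [|n IH].
    rewrite (_ : extinct_by 0 = set0) ?/pr ?measure0//.
    by apply/seteqP; split.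
  apply: (le_trans (pr_extinct_byS N n)).
  suff : \sum_(i < N) m_ i * (1 - s ^+ i) <=
      \sum_(i < N) m_ i * (1 - pr (extinct_by n) ^+ i) by lra.
  apply: ler_sum => i _; apply: ler_wpM2l; first exact: offspring_prob_ge0.
  by rewrite lerD2l lerN2 lerXn2r// ?nnegrE ?pr_ge0.
have mU : measurable (\bigcup_n extinct_by n).
  by apply: bigcupT_measurable => n; exact: measurable_extinct_by.
have le_s : (nu (\bigcup_n extinct_by n) <= s%:E)%E.
  have cv : (nu \o extinct_by) x @[x --> \oo] --> nu (\bigcup_n extinct_by n).
    apply: nondecreasing_cvg_mu => //; first exact: measurable_extinct_by.
    move=> n m nm; apply/subsetPset => t e; rewrite /extinct_by /= -(subnKC nm).
    exact: level_nil_add.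
  rewrite -(cvg_lim _ cv)//; apply: lime_le; first by apply/cvg_ex; eexists; exact: cv.
  by apply: nearW => n /=; rewrite prE ?lee_fin//; exact: measurable_extinct_by.
rewrite -lte_fin -prE; last exact: measurable_surviving_trees.
rewrite surviving_treesE probability_setC// sube_gt0.
by apply: le_lt_trans le_s _; rewrite lte_fin.
Qed.

End supercritical_branching.

(** * Growth of the number of surviving vertices *)

Section growth.
Context (R : realType) (mu : probability nat R) (nu : probability tree_space R).
Hypothesis br : branching mu nu.
Hypothesis mean_gt1 : (1 < \sum_(0 <= i <oo) i%:R%:E * mu [set i])%E.
Local Notation m_ := (offspring_prob mu).
Local Notation pr := (pr nu).
Implicit Types (A : set tree_space).

(** For [A] contained in [surviving_trees], child [j] is the first surviving one and its subtree
    lies in [A]. *)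
Definition first_surviving_at A j : set tree_space :=
  [set t | [set m | (j < m)%N] (t [::]) /\ forall l, (l < j.+1)%N ->
    (if (l < j)%N then ~` surviving_trees else A) (subtree t [:: l])].

Definition first_surviving A := \bigcup_j first_surviving_at A j.

Lemma measurable_first_surviving_at A j :
  measurable A -> measurable (first_surviving_at A j).
Proof.
move=> mA; apply: (@measurable_branch j.+1
  (fun l => if (l < j)%N then ~` surviving_trees else A)) => l.
by case: ifP => // _; apply: measurableC; exact: measurable_surviving_trees.
Qed.

Lemma measurable_first_surviving A : measurable A -> measurable (first_surviving A).
Proof.
by move=> mA; apply: bigcupT_measurable => j; exact: measurable_first_surviving_at.
Qed.

Lemma first_survivingP A t : survives t -> (forall j, (j < t [::])%N ->
  survives (subtree t [:: j]) -> A (subtree t [:: j])) -> first_surviving A t.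
Proof.
move=> st H; have ex : exists j, (j < t [::])%N && `[< survives (subtree t [:: j]) >].
  by have [j jt /asboolP sj] := survives_down st; exists j; rewrite jt.
case: (ex_minnP ex) => j /andP[jt /asboolP sj] jmin.
exists j => //; split => //= l; rewrite ltnS => lj; case: ifPn => [lt|]; last first.
  by rewrite -leqNgt => jl; rewrite (_ : l = j); [exact: H|apply/eqP; rewrite eqn_leq lj].
move=> sl; have := jmin l; rewrite (ltn_trans lt jt) leqNgt lt.
by move=> /(_ (asboolT sl)).
Qed.

Lemma first_surviving_surviving : first_surviving surviving_trees = surviving_trees.
Proof.
apply/seteqP; split=> [t [j _ [jt /(_ j (ltnSn j))]]|t st]; last exact: first_survivingP.
rewrite ltnn => sj; have : [:: j] \in level t 1 by rewrite level_1 map_f// mem_iota.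
by move=> /survives_up; exact.
Qed.

Lemma first_surviving_prob_sum A : measurable A -> A `<=` surviving_trees ->
  nu (first_surviving A) = ((pr A)%:E *
    \sum_(0 <= j <oo) (fine (mu [set m | (j < m)%N]) * pr (~` surviving_trees) ^+ j)%:E)%E.
Proof.
move=> mA As; rewrite measure_semi_bigcup; first last.
- exact: measurable_first_surviving.
- apply/trivIsetP => i j _ _; wlog ij : i j / (i < j)%N => [W|] ne.
    case: (ltngtP i j) => ij; [exact: W| |by rewrite ij eqxx in ne].
    by rewrite setIC; apply: W => //; rewrite eq_sym.
  apply/seteqP; split=> // t [[_ /(_ i (ltnSn i))] + [_ /(_ i (ltnW _))]].
  by rewrite ltnn ij => /As si /(_ ij).
- by move=> j; exact: measurable_first_surviving_at.
rewrite -nneseriesZl; last first.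
  by move=> i _; rewrite lee_fin mulr_ge0 ?fine_ge0// exprn_ge0// pr_ge0.
apply: eq_eseriesr => j _.
transitivity (pr (first_surviving_at A j))%:E.
  by apply: prE; exact: measurable_first_surviving_at.
rewrite -EFinM; congr (_%:E).
have mC l : measurable (if (l < j)%N then ~` surviving_trees else A).
  by case: ifP => // _; apply: measurableC; exact: measurable_surviving_trees.
rewrite (@pr_branch _ _ _ br j.+1
  (fun l => if (l < j)%N then ~` surviving_trees else A) [set m | (j < m)%N] mC).
rewrite big_ord_recr /= ltnn.
under eq_bigr => i _ do rewrite ltn_ord.
by rewrite prodr_const card_ord; ring.
Qed.

(** The factor multiplying [pr A] in [first_surviving_prob_sum] does not depend on [A]. The case
    [A = surviving_trees], of positive probability, shows that it is [1]. *)
Lemma first_surviving_prob A : measurable A -> A `<=` surviving_trees ->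
  pr (first_surviving A) = pr A.
Proof.
move=> mA As; have p0 := survival_prob_gt0 br mean_gt1.
have := first_surviving_prob_sum measurable_surviving_trees (@subset_refl _ _).
rewrite first_surviving_surviving (prE nu measurable_surviving_trees).
rewrite -[pr (first_surviving A)]/(fine _) first_surviving_prob_sum//.
case: (\sum_(0 <= j <oo) _)%E => [r| |].
- rewrite -!EFinM /= => -[e]; have -> : r = 1; last by rewrite mulr1.
  by apply: (mulfI (lt0r_neq0 p0)); rewrite mulr1 -e.
- by rewrite gt0_muley// lte_fin.
- by rewrite gt0_muleNy// lte_fin.
Qed.

(** Fixing the offspring number at [i.+2] guarantees that children [0] and [1] exist; the survival
    of child [1] supplies the extra surviving vertex. *)
Definition branch_event i A : set tree_space :=
  [set t | [set i.+2] (t [::]) /\ forall l, (l < i.+2)%N ->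
    (if l == 0%N then A else if l == 1%N then surviving_trees else setT)
      (subtree t [:: l])].

Lemma measurable_branch_event i A : measurable A -> measurable (branch_event i A).
Proof.
move=> mA; apply: (@measurable_branch i.+2
  (fun l => if l == 0%N then A else if l == 1%N then surviving_trees else setT)) => l.
by case: ifP => // _; case: ifP => // _; exact: measurable_surviving_trees.
Qed.

Lemma branch_event_prob i A : measurable A ->
  pr (branch_event i A) = m_ i.+2 * pr surviving_trees * pr A.
Proof.
move=> mA; rewrite (@pr_branch _ _ _ br i.+2
  (fun l => if l == 0%N then A else if l == 1%N then surviving_trees else setT)); last first.
  by move=> l; case: ifP => // _; case: ifP => // _; exact: measurable_surviving_trees.
rewrite !big_ord_recl big1 => [|l _]; last by rewrite /pr /= probability_setT.
by rewrite /= mulr1 /offspring_prob; ring.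
Qed.

Lemma branch_event_first_surviving i A : A `<=` surviving_trees ->
  branch_event i A `<=` first_surviving A.
Proof.
move=> As t [t2 H]; exists 0%N => //; split; first by rewrite t2.
by move=> [|//] _; exact: (H 0%N).
Qed.

(** Otherwise the mean would be at most [m_ 1], hence at most [1]. *)
Lemma exists_branching : exists i, 0 < m_ i.+2.
Proof.
apply: contrapT => /forallNP H.
have [N] := mean_truncation mean_gt1; apply/negP; rewrite -leNgt.
have m1 : m_ 1%N <= 1 by rewrite -lee_fin -offspring_probE probability_le1.
case: N => [|[|N]]; rewrite ?big_ord0 ?big_ord_recl ?big_ord0 ?mul0r ?add0r ?ler01//.
rewrite big1 ?addr0 ?mul1r// => i _.
have -> : m_ (lift ord0 (lift ord0 i)) = 0; last by rewrite mulr0.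
apply/eqP; rewrite eq_le offspring_prob_ge0 andbT leNgt; exact/negP/H.
Qed.

Definition few_surviving k m : set tree_space := [set t | (0 < nsurv k t <= m)%N].

Lemma measurable_few_surviving k m : measurable (few_surviving k m).
Proof.
rewrite (_ : few_surviving k m =
    \bigcup_(j in [set j | (0 < j <= m)%N]) [set t | nsurv k t = j]).
  by apply: bigcup_measurable => j _; exact: measurable_nsurv.
by apply/seteqP; split=> [t H|t [j /= H e]]; [exists (nsurv k t)|rewrite /few_surviving /= e].
Qed.

Lemma few_surviving_sub k m : few_surviving k m `<=` surviving_trees.
Proof. by move=> t /andP[/nsurv_gt0]. Qed.

(* [nsurv k.+1] of a tree is at least [nsurv k] of its first surviving child, and
   larger if a second child survives. *)
Lemma few_survivingS i k m : few_surviving k.+1 m.+1 `<=`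
  (first_surviving (few_surviving k m.+1) `\` branch_event i (few_surviving k m.+1))
  `|` branch_event i (few_surviving k m).
Proof.
move=> t /andP[/nsurv_gt0 st tm].
have child j : (j < t [::])%N -> (nsurv k (subtree t [:: j]) <= m.+1)%N.
  move=> jt; apply: leq_trans tm; rewrite nsurvS.
  by rewrite (bigD1 (Ordinal jt))//= leq_addr.
case: (pselect (branch_event i (few_surviving k m.+1) t)) => [[t2 H]|nb]; last first.
  left; split=> //; apply: first_survivingP => // j jt sj.
  by apply/andP; split; [exact/nsurv_gt0|exact: child].
right; split=> // l li; have := H l li; case: ifP => // /eqP l0; rewrite l0.
move=> /andP[n0 _]; apply/andP; split => //.
have /nsurv_gt0 -/(_ k) s1 : survives (subtree t [:: 1%N]) by exact: (H 1%N).
rewrite -ltnS; apply: leq_trans tm; rewrite nsurvS t2 !big_ord_recl /=.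
by rewrite addnA -addn1 -addnA leq_add2l ltn_addr.
Qed.

End growth.

(** Every survivor of height [n] has at least one surviving descendant of height [n']. *)
Lemma leq_nsurv t n n' : (n <= n')%N -> (nsurv n t <= nsurv n' t)%N.
Proof.
move=> nn; rewrite -(subnKC nn) nsurv_add /nsurv -sum1_count big_mkcond /=.
apply: leq_sum => v _; case: ifP => // /asboolP sv; exact/nsurv_gt0.
Qed.

Section linear_growth.
Context (R : realType) (mu : probability nat R) (nu : probability tree_space R).
Hypothesis br : branching mu nu.
Hypothesis mean_gt1 : (1 < \sum_(0 <= i <oo) i%:R%:E * mu [set i])%E.
Local Notation m_ := (offspring_prob mu).
Local Notation pr := (pr nu).

Lemma few_surviving_recursion i k m :
  pr (few_surviving k.+1 m.+1) <=
    (1 - m_ i.+2 * pr surviving_trees) * pr (few_surviving k m.+1) +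
    m_ i.+2 * pr surviving_trees * pr (few_surviving k m).
Proof.
have mU k' m' := measurable_few_surviving k' m'.
have mF := measurable_first_surviving (mU k m.+1).
have mB m' := measurable_branch_event i (mU k m').
have mD := measurableD mF (mB m.+1).
have : (nu (few_surviving k.+1 m.+1) <=
    nu (first_surviving (few_surviving k m.+1) `\` branch_event i (few_surviving k m.+1))
    + nu (branch_event i (few_surviving k m)))%E.
  apply: le_trans (measureU2 _ mD (mB m)).
  by apply: le_measure; rewrite ?inE; [|exact: measurableU|exact: few_survivingS].
set F := first_surviving _ in mF mD *; set B := branch_event i (few_surviving k m.+1) in mD *.
have -> : nu (F `\` B) = (pr F - pr B)%:E.
  rewrite measureD//; [|exact: mB|by rewrite -ge0_fin_numE// fin_num_measure].
  have -> : F `&` B = B by exact/setIidPr/branch_event_first_surviving/few_surviving_sub.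
  by rewrite EFinB; congr (_ - _)%E; apply: prE => //; exact: mB.
rewrite !(prE nu)// -EFinD lee_fin /F /B !(branch_event_prob br)//.
rewrite (first_surviving_prob br mean_gt1)//; last exact: few_surviving_sub.
by move=> /le_trans; apply; lra.
Qed.

Lemma few_surviving_decay : exists2 theta, 0 <= theta < 1 &
  forall k m, pr (few_surviving k m) <= theta ^+ k * 2 ^+ m.
Proof.
have [i mi] := exists_branching mean_gt1.
have p0 := survival_prob_gt0 br mean_gt1.
pose b := m_ i.+2 * pr surviving_trees.
have b0 : 0 < b by exact: mulr_gt0.
have b1 : b <= 1.
  rewrite mulr_ile1 ?(ltW mi) ?(ltW p0)//; last exact: pr_le1 measurable_surviving_trees.
  by rewrite -lee_fin -offspring_probE probability_le1.
(* This value turns the recursion with weights [2 ^+ m] into an equality: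
   [(1 - b) * 2 + b = 2 * (1 - b / 2)]. *)
exists (1 - b / 2); first lra.
have t0 k : 0 <= (1 - b / 2) ^+ k by rewrite exprn_ge0//; lra.
elim=> [|k IH] m.
  rewrite expr0 mul1r; apply: (@le_trans _ _ 1).
    by apply: pr_le1; exact: measurable_few_surviving.
  by rewrite exprn_ege1// ler1n.
case: m => [|m].
  have -> : few_surviving k.+1 0 = set0.
    by apply/seteqP; split=> // t /andP[n0]; rewrite leqNgt n0.
  by rewrite /pr measure0 mulr_ge0.
apply: (le_trans (few_surviving_recursion i k m)); rewrite -/b.
have h1 := IH m.+1; have h2 := IH m.
have e1 : (1 - b) * pr (few_surviving k m.+1) <=
  (1 - b) * ((1 - b / 2) ^+ k * 2 ^+ m.+1) by apply: ler_wpM2l => //; lra.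
have e2 : b * pr (few_surviving k m) <= b * ((1 - b / 2) ^+ k * 2 ^+ m).
  by apply: ler_wpM2l => //; lra.
apply: (le_trans (lerD e1 e2)); rewrite !exprS.
lra.
Qed.

Lemma linear_growth_prob : exists2 J, (0 < J)%N &
  nu.-negligible [set t | ~ (survives t ->
    exists m, forall n, (m <= n)%N -> (n <= J * nsurv n t)%N)].
Proof.
have [theta /andP[th0 th1] decay] := few_surviving_decay.
(* With [theta ^+ J <= 1 / 4], the bound for [few_surviving (J * m) m] becomes [(2 / 4) ^+ m], which
   is summable as Borel-Cantelli requires. *)
have [J J0 thJ] : exists2 J, (0 < J)%N & theta ^+ J <= 4^-1.
  have /cvgrPdist_lt/(_ 4^-1) : (fun n => theta ^+ n) @ \oo --> 0.
    by apply: cvg_expr; rewrite ger0_norm.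
  move=> /(_ _)[|N _ H]; first by rewrite invr_gt0.
  exists N.+1 => //; have := H N.+1 (leqnSn N).
  by rewrite /= sub0r normrN ger0_norm ?exprn_ge0// => /ltW.
exists J => //.
pose F m := few_surviving (J * m) m.
have mF m : measurable (F m) by exact: measurable_few_surviving.
have prF m : pr (F m) <= 2^-1 ^+ m.
  apply: (le_trans (decay _ _)); rewrite exprM -exprMn lerXn2r ?nnegrE//.
    by rewrite mulr_ge0// exprn_ge0.
  by lra.
have geo N : \sum_(m < N) (2^-1 : R) ^+ m <= 2.
  have -> : \sum_(m < N) (2^-1 : R) ^+ m = 2 - 2 * 2^-1 ^+ N.
    elim: N => [|N IH]; first by rewrite big_ord0 expr0; lra.
    by rewrite big_ord_recr /= IH exprS; field.
  by rewrite lerBlDr lerDl mulr_ge0// exprn_ge0.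
have lim0 : nu (lim_sup_set F) = 0%E.
  apply: lim_sup_set_cvg0 => //; apply: (@le_lt_trans _ _ 2%:E); last by rewrite ltry.
  apply: lime_le; first by apply: is_cvg_nneseries.
  apply: nearW => N; rewrite big_mkord.
  apply: (@le_trans _ _ (\sum_(m < N) (2^-1 ^+ m)%:E)%E).
    apply: lee_sum => m _; apply: (@le_trans _ _ (pr (F m))%:E); last by rewrite lee_fin.
    by rewrite -(prE nu (mF m)).
  by rewrite sumEFin lee_fin.
exists (lim_sup_set F); split=> //.
  apply: bigcapT_measurable => n; apply: bigcup_measurable => m _; exact: mF.
move=> t /= /not_implyP[st H] n _; apply: contrapT => Hn; apply: H.
have big m : (n <= m)%N -> (m < nsurv (J * m) t)%N.
  move=> nm; rewrite ltnNge; apply/negP => le; apply: Hn; exists m => //.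
  by apply/andP; split=> //; exact/nsurv_gt0.
(* An arbitrary height [k] is compared with the multiple [J * (k %/ J)] of [J] below it, using that
   [nsurv] is nondecreasing in the height. *)
exists (J * n)%N => k Jn.
have nk : (n <= k %/ J)%N by rewrite leq_divRL// mulnC.
have kJ : (J * (k %/ J) <= k)%N by rewrite mulnC leq_trunc_div.
apply: leq_trans (ltnW (ltn_ceil k J0)) _.
rewrite mulnC leq_mul2l; apply/orP; right.
exact: leq_trans (big _ nk) (leq_nsurv t kJ).
Qed.

(** By induction on [v], since the branching property with a constraint on child [j] alone gives its
    subtree the law [nu]. *)
Lemma negligible_subtree v (A : set tree_space) : nu.-negligible A ->
  nu.-negligible [set t | A (subtree t v)].
Proof.
move=> [B [mB B0 AB]]; exists [set t | B (subtree t v)]; split.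
- exact: measurable_subtree_preimage.
- elim: v B mB B0 {AB} => [//|j v IH] B mB B0.
  pose C : set tree_space := [set t | B (subtree t v)].
  have mC : measurable C by exact: measurable_subtree_preimage.
  have C0 : nu C = 0%E by exact: IH.
  have mA l : measurable (if l == j then C else setT) by case: ifP.
  have := @br j.+1 (fun l => if l == j then C else setT) setT mA.
  rewrite big_ord_recr /= eqxx C0 !mule0 => e0.
  apply: subset_measure0 e0 => //; [exact: measurable_subtree_preimage| |].
    exact: (@measurable_branch j.+1 (fun l => if l == j then C else setT) setT).
  move=> t; rewrite /= -cat1s -subtree_cat => Bt; split=> // l _.
  by case: eqP => // ->.
- by move=> t /AB.
Qed.

Lemma linear_growth_ae : exists2 J, (0 < J)%N &
  nu.-negligible [set t | ~ linear_growth t J].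
Proof.
have [J J0 neg] := linear_growth_prob; exists J => //.
pose N v := [set t : tree_space | ~ (survives (subtree t v) ->
    exists m, forall n, (m <= n)%N -> (n <= J * nsurv n (subtree t v))%N)].
have Nv v : nu.-negligible (N v) by exact: (negligible_subtree v neg).
(* There are countably many words; an integer encoding none contributes [set0]. *)
have : nu.-negligible (\bigcup_k oapp N set0 (unpickle k)).
  apply: negligible_bigcup => k; case: (unpickle k) => [v|] /=; first exact: Nv.
  exact: negligible_set0.
apply: negligibleS => t /existsNP[v /not_implyP[/asboolP sv H]].
by exists (pickle v) => //; rewrite pickleK /=; apply/not_implyP.
Qed.

End linear_growth.

Lemma cond_survival_negligible d (Omega : measurableType d) (R : realType)
    (P : probability Omega R) (X : seq nat -> {RV P >-> nat}) (Q : set Omega) :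
  P (survival X) != 0%E -> P.-negligible (survival X `&` Q) ->
  (cond_survival X).-negligible Q.
Proof.
move=> pS [N [mN N0 QN]]; have mS := measurable_survival X.
(* The complement of survival has conditional probability [0], so it can be added to the exceptional
   set. *)
exists (N `|` ~` survival X); split.
- exact: measurableU mN (measurableC mS).
- rewrite /cond_survival /= /mnormalize /= /mrestr setTI (negbTE pS) /=.
  have -> : (P (survival X) == +oo)%E = false.
    by apply/negbTE; rewrite lt_eqF// ltey_eq fin_num_measure.
  rewrite setIUl setICl setU0 (@subset_measure0 _ _ _ P _ _ _ mN) ?mul0e//.
  exact: measurableI.
- by move=> w Qw; case: (pselect (survival X w)) => [Sw|]; [left; apply: QN|right].
Qed.

Theorem theorem1 (R : realType) (mu : probability nat R)
    (d : measure_display) (Omega : measurableType d) (P : probability Omega R)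
    (X : seq nat -> {RV P >-> nat})
    (mean_gt1 : (1 < \sum_(0 <= i <oo) i%:R%:E * mu [set i])%E)
    (GW : galton_watson X mu) :
  {ae cond_survival X, forall w,
     weakly_anchored_hyperbolic (causal_map R (random_tree X w))} /\
  {ae cond_survival X, forall w,
     exists g : int -> vertex (causal_map R (random_tree X w)),
       bi_infinite_geodesic g}.
Proof.
have br := gw_law_branching GW.
have pS : P (survival X) != 0%E.
  rewrite -[P _]/(gw_law X surviving_trees) (prE _ measurable_surviving_trees).
  by rewrite gt_eqF// lte_fin; exact: survival_prob_gt0 br mean_gt1.
have [J J0 [B [mB B0 HB]]] := linear_growth_ae br mean_gt1.
(* This reduces both claims to deterministic statements about one surviving tree with linear
   growth. *)
have ae (Q : set Omega) :
    (forall w, survives (random_tree X w) -> linear_growth (random_tree X w) J -> Q w) ->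
    {ae cond_survival X, forall w, Q w}.
  move=> HQ; apply: cond_survival_negligible => //.
  exists (gw_tree X @^-1` B); split=> //; first exact: measurable_funPTI.
  by move=> w [Sw nQ]; apply: HB => growth; apply: nQ; exact: HQ.
split; apply: ae => w Sw growth; have [g [K [rg sep]]] := separated_rays J0 Sw growth.
  exact: causal_weakly_anchored_hyperbolic rg sep.
have r0 := rg 0%N isT; have r1 := rg 1%N isT.
apply: (@causal_bi_infinite_geodesic _ _ K _ _ r0 r1) => k; exact: sep.
Qed.
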